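(* Let $(M,g)$ be a connected smooth Riemannian manifold of dimension $n$ and let $T\in L^1_{\mathrm{loc}}(\operatorname{Sym}^2T^*M)$ satisfy $T\ge 0$ (positive semidefinite almost everywhere) and $$\int_M\langle T,\operatorname{Hess}\phi\rangle\,dV_g=0\qquad\text{for every }\phi\in C_c^\infty(M).$$ Assume that $$T\ge\frac1\kappa(\operatorname{tr}_gT)\,g$$ almost everywhere, where $\kappa:M\to[n,\infty)$ is bounded on compact sets. If $T=0$ almost everywhere on one nonempty open set, then $T=0$ almost everywhere on all of $M$.
   Context: No completeness or compactness of $(M,g)$ is assumed. $\operatorname{Hess}\phi$ is the Riemannian Hessian, $\langle\cdot,\cdot\rangle$ the inner product on symmetric $2$-tensors induced by $g$, $dV_g$ the Riemannian volume, and inequalities between symmetric $2$-tensors are in the sense of quadratic forms. *)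

(* Defs.v *)
From mathcomp Require Import all_boot all_order all_algebra.
From mathcomp Require Import all_classical all_reals all_analysis.
Set Implicit Arguments.
Unset Strict Implicit.
Unset Printing Implicit Defensive.
Import Order.TTheory GRing.Theory Num.Theory.
Import numFieldNormedType.Exports.
Local Open Scope classical_set_scope.
Local Open Scope ring_scope.

Notation borel X := (g_sigma_algebraType (@open X)).

(* Lebesgue measure on R^n as an iterated product; R^0 is a point of mass 1. *)
Fixpoint lebesgue_rV (R : realType) (n : nat) :
    set (borel 'rV[R]_n) -> \bar R :=
  match n with
  | 0%N => \d_(0 : borel 'rV[R]_0)
  | k.+1 => pushforward (@lebesgue_measure R \x @lebesgue_rV R k)%E
      ((fun p => row_mx p.1%:M p.2 : 'rV[R]_(1 + k)) :
         measurableTypeR R * borel 'rV[R]_k -> borel 'rV[R]_k.+1)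
  end.

Definition pderiv (R : realType) (n : nat) (a : 'I_n) (f : 'rV[R]_n -> R) :
  'rV[R]_n -> R := 'D_(delta_mx 0 a) f.

(* [U] is meant to be open; f is C^k iff its partial derivatives of order at
   most k exist and are continuous. *)
Fixpoint Ck_on (R : realType) (n : nat) (k : nat) (U : set 'rV[R]_n)
    (f : 'rV[R]_n -> R) : Prop :=
  (forall x, U x -> {for x, continuous f}) /\
  match k with
  | 0%N => True
  | l.+1 => forall a : 'I_n,
      (forall x, U x -> derivable f x (delta_mx 0 a)) /\
      Ck_on l U (pderiv a f)
  end.

Definition smooth_on (R : realType) (n : nat) (U : set 'rV[R]_n)
  (f : 'rV[R]_n -> R) : Prop := forall k, Ck_on k U f.

(* The values of [cmap] outside [cdom], and of [cinv] outside the image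
   of [cdom], are irrelevant. *)
Record chart (R : realType) (n : nat) (X : ptopologicalType) := Chart {
  cdom : set X;
  cmap : X -> 'rV[R]_n;
  cinv : 'rV[R]_n -> X;
  cdom_open : open cdom;
  cimg_open : open (cmap @` cdom);
  cmapK : forall p, cdom p -> cinv (cmap p) = p;
  cmap_continuous : forall p, cdom p -> {for p, continuous cmap};
  cinv_continuous : forall x, (cmap @` cdom) x -> {for x, continuous cinv} }.

Definition cimg (R : realType) (n : nat) (X : ptopologicalType)
  (c : chart R n X) : set 'rV[R]_n := cmap c @` cdom c.

(* A smooth manifold of dimension [n], without boundary, given by an atlas;
   [chart_at p] is an arbitrary chart of the atlas around [p]. *)
Record manifold (R : realType) (n : nat) := Manifold {
  carrier :> ptopologicalType;
  hausdorff_carrier : hausdorff_space carrier;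
  second_countable_carrier : @second_countable carrier;
  chart_index : Type;
  chart_of : chart_index -> chart R n carrier;
  chart_at : carrier -> chart_index;
  mem_chart_at : forall p, cdom (chart_of (chart_at p)) p;
  smooth_transition : forall (i j : chart_index) (a : 'I_n),
    smooth_on (cmap (chart_of i) @` (cdom (chart_of i) `&` cdom (chart_of j)))
      (fun x => cmap (chart_of j) (cinv (chart_of i) x) 0 a) }.

Section Tensors.
Context {R : realType} {n : nat} {M : manifold R n}.

Definition dom (i : chart_index M) : set M := cdom (chart_of i).
Definition coord (i : chart_index M) : M -> 'rV[R]_n := cmap (chart_of i).
Definition param (i : chart_index M) : 'rV[R]_n -> M := cinv (chart_of i).
Definition img (i : chart_index M) : set 'rV[R]_n := cimg (chart_of i).

Definition smooth_fun (f : M -> R) : Prop :=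
  forall i : chart_index M, smooth_on (img i) (f \o param i).

(* C_c^infty(M) *)
Definition test_function (f : M -> R) : Prop :=
  smooth_fun f /\ compact (closure [set p | f p != 0]).

(* A section of Sym^2 T^*M, given by its components
   [T i p a b = T(d/dx^a, d/dx^b)(p)] in every chart [i] of the atlas around
   [p] ([T i p] is irrelevant when [p] is not in [dom i]).  With mathcomp's
   row-vector convention, row [a] of ['J y] is [d y / d x^a]. *)
Record sym2tensor := Sym2tensor {
  components :> chart_index M -> M -> 'M[R]_n;
  components_sym : forall i p, dom i p -> (components i p)^T = components i p;
  components_change : forall i j p, dom i p -> dom j p ->
    let J := 'J (coord j \o param i) (coord i p) in
    components i p = J *m components j p *m J^T }.

Definition quadform (A : 'M[R]_n) (v : 'rV[R]_n) : R := (v *m A *m v^T) 0 0.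

Record metric := Metric {
  metric_tensor :> sym2tensor;
  metric_smooth : forall i a b,
    smooth_on (img i) (fun x => metric_tensor i (param i x) a b);
  metric_posdef : forall i p v, dom i p -> v != 0 ->
    0 < quadform (metric_tensor i p) v }.

Implicit Types (g : metric) (T S : chart_index M -> M -> 'M[R]_n).

(* Gamma^c_{ab}, as a function of the coordinates of the chart [i] *)
Definition christoffel g (i : chart_index M) (c a b : 'I_n) (x : 'rV[R]_n) : R :=
  let gi a b := fun y => g i (param i y) a b in
  2^-1 * \sum_(d < n) invmx (g i (param i x)) c d *
    (pderiv a (gi b d) x + pderiv b (gi a d) x - pderiv d (gi a b) x).

(* Hess phi = nabla d phi, in components *)
Definition hess g (phi : M -> R) (i : chart_index M) (p : M) : 'M[R]_n :=
  \matrix_(a, b)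
    let x := coord i p in
    let f := phi \o param i in
    pderiv a (pderiv b f) x - \sum_(c < n) christoffel g i c a b x * pderiv c f x.

(* The scalars and inequalities below do not depend on the chart around [p] in
   which they are computed; [chart_at p] is used. *)

(* <S, T> = g^{ac} g^{bd} S_ab T_cd *)
Definition tensor_inner g S T (p : M) : R :=
  let i := chart_at p in
  \sum_(a < n) \sum_(b < n) \sum_(c < n) \sum_(d < n)
    invmx (g i p) a c * invmx (g i p) b d * S i p a b * T i p c d.

Definition tensor_trace g T (p : M) : R :=
  let i := chart_at p in \tr (invmx (g i p) *m T i p).

Definition tensor_eq0 T (p : M) : Prop := T (chart_at p) p = 0.

(* [c * S <= T] at [p], in the sense of quadratic forms *)
Definition tensor_le (c : R) S T (p : M) : Prop :=
  let i := chart_at p in forall v, c * quadform (S i p) v <= quadform (T i p) v.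

Definition tensor_ge0 T (p : M) : Prop :=
  forall v, 0 <= quadform (T (chart_at p) p) v.

(* dV_g; since [M] is second countable, at most one Borel measure satisfies
   this. *)
Definition is_volume g (mu : {measure set (borel M) -> \bar R}) : Prop :=
  forall (i : chart_index M) (A : set (borel M)), measurable A -> A `<=` dom i ->
    mu A = (\int[@lebesgue_rV R n]_(x in (coord i @` A : set (borel 'rV[R]_n)))
              (Num.sqrt (\det (g i (param i x))))%:E)%E.

Definition L1loc g (mu : {measure set (borel M) -> \bar R}) T : Prop :=
  (forall i a b, measurable_fun (dom i : set (borel M)) (fun p => T i p a b)) /\
  (forall K : set M, compact K ->
    mu.-integrable (K : set (borel M))
      (fun p => (Num.sqrt (tensor_inner g T T p))%:E)).

End Tensors.
Arguments sym2tensor {R n} M.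
Arguments metric {R n} M.

(* Main.v *)
(* Let Z be the open set of points near which T = 0 almost everywhere; the
   point is that Z is closed.  In a chart, suppose that T = 0 near the centre z
   of a Euclidean ball of squared radius r with closure in the image.  Put
   s(x) = r - |x - z|^2 and test with phi = G(s), where G(s) = exp(-b/s) for
   s > 0 and G = 0 otherwise.  Then
     <T, Hess phi> = G''(s) T(grad s, grad s) + G'(s) <T, Hess s>
                  >= G'(s) tr T ((G''/G') |ds|^2 / kappa - C),
   using T >= (tr T / kappa) g for the first term and T >= 0 with a local bound
   Hess s >= -C g for the second.  Away from z, |ds|^2 is bounded below, and
   G''/G' is as large as we want on (0, r] when b is large; near z the integrand
   is zero.  So <T, Hess phi> >= G'(s) tr T >= 0 almost everywhere, and as the
   integral is zero, tr T = 0, hence T = 0, on the whole ball. *)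
Require Import Defs.
From HB Require Import structures.
From mathcomp Require Import all_boot all_order all_algebra.
From mathcomp Require Import all_classical all_reals all_analysis.
From mathcomp Require Import measurable_realfun.
From mathcomp Require Import ring lra.
(* [vector.coord] shadows the [coord] of Defs. *)
Import Defs.
Import Order.TTheory GRing.Theory Num.Theory.
Import numFieldNormedType.Exports.
Local Open Scope classical_set_scope.
Local Open Scope ring_scope.

Set Implicit Arguments.
Unset Strict Implicit.
Unset Printing Implicit Defensive.

(** The pointwise estimate rests on one fact: with [S = g^-1 T g^-1], the product [<T, H>] is
    [tr (S H)], which is nonnegative as soon as [S] and [H] are positive semidefinite. Sums of
    absolute values of entries take the place of eigenvalues in all bounds. Two points shape the
    rest. The inner product is evaluated in [chart_at p], which varies arbitrarily with [p], so the
    Hessian must be shown to transform as a tensor before a computation in one chart says anything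
    about the integrand. And the integral hypothesis carries no measurability of the integrand, so
    the conclusion is drawn from a measurable nonnegative minorant, [G'(s) |tr T|]. For closedness
    at a limit point [p] of Z, the ball is centred not at [p] but at a nearby point [q] of Z, with a
    radius that still reaches [p]; so [T] does vanish around its centre. *)

(** * Differential calculus on row vectors: Taylor expansion and symmetry of second derivatives *)

Section Calculus.
Context {R : realType}.

Lemma mx_entry_le m n (A : 'M[R]_(m, n)) i j : `|A i j| <= `|A|.
Proof.
rewrite [leRHS]/Num.Def.normr/= mx_normrE.
exact: (le_bigmax _ (fun k => `|A k.1 k.2|) (i, j)).
Qed.

Lemma mx_norm_leP m n (A : 'M[R]_(m, n)) e : 0 <= e ->
  (forall i j, `|A i j| <= e) -> `|A| <= e.
Proof.
move=> e0 H; rewrite [leLHS]/Num.Def.normr/= mx_normrE.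
by apply: bigmax_le => // -[i j] _ /=.
Qed.

Lemma open_rV_ball n (U : set 'rV[R]_n) x : open U -> U x ->
  exists2 e : R, 0 < e & forall y, `|y - x| < e -> U y.
Proof.
move=> oU Ux; have /nbhs_ballP[e /= e0 eU] : nbhs x U by exact: open_nbhs_nbhs.
by exists e => // y yx; apply: eU; rewrite -ball_normE /= distrC.
Qed.

Lemma continuous_rVP n (f : 'rV[R]_n -> R) (x : 'rV[R]_n) : {for x, continuous f} <->
  forall e : R, 0 < e ->
    exists2 d : R, 0 < d & forall y : 'rV[R]_n, `|y - x| < d -> `|f y - f x| < e.
Proof.
split.
  move=> /cvgrPdist_lt fc e e0; have /nbhs_ballP[d /= d0 H] := fc e e0.
  by exists d => // y yx; rewrite distrC; apply: H; rewrite -ball_normE /= distrC.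
move=> H; have FF : Filter (nbhs x) by exact: nbhs_filter.
apply/(@cvgrPdist_lt _ _ _ _ FF) => e e0; have [d d0 Hd] := H e e0.
apply/nbhs_ballP; exists d => //= y; rewrite -ball_normE /= => yx.
by rewrite distrC; apply: Hd; rewrite distrC.
Qed.

Lemma cvg_sumR (T I : Type) (F : set_system T) {FF : Filter F} (r : seq I)
    (f : I -> T -> R) (l : I -> R) :
  (forall i, f i x @[x --> F] --> l i) ->
  \sum_(i <- r) f i x @[x --> F] --> \sum_(i <- r) l i.
Proof.
by move=> fl; apply: cvg_big => //; exact: add_continuous.
Qed.

Lemma is_derive_line n (f : 'rV[R]_n -> R) (x v : 'rV[R]_n) (t : R) :
  derivable f (x + t *: v) v ->
  is_derive t 1 (fun s : R => f (x + s *: v)) ('D_v f (x + t *: v)).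
Proof.
move=> df; have E : (fun h : R => h^-1 *: (((fun s : R => f (x + s *: v)) \o shift t) (h *: 1)
    - f (x + t *: v))) = (fun h : R => h^-1 *: ((f \o shift (x + t *: v)) (h *: v) - f (x + t *: v))).
  apply/funext => h /=; congr (_ *: (f _ - _)).
  by rewrite [h *: 1]mulr1 scalerDl addrCA.
apply: DeriveDef; first by rewrite /derivable E.
by rewrite /derive E.
Qed.

(** The increment [h] may have either sign, so the intermediate point is located only by
    [|t| <= |h|]; the classical theorem is applied on [[0, h]] or on [[h, 0]]. *)
Lemma MVT_line n (f : 'rV[R]_n -> R) (x v : 'rV[R]_n) (h : R) :
  (forall t : R, `|t| <= `|h| -> derivable f (x + t *: v) v) ->
  exists2 t : R, `|t| <= `|h| & f (x + h *: v) - f x = h * 'D_v f (x + t *: v).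
Proof.
move=> df; pose F (t : R) := f (x + t *: v).
have dF (t : R) : `|t| <= `|h| -> is_derive t 1 F ('D_v f (x + t *: v)).
  by move=> th; apply: is_derive_line; exact: df.
have cF (a b : R) : (forall t, t \in `[a, b] -> `|t| <= `|h|) -> {within `[a, b], continuous F}.
  by move=> H; apply: derivable_within_continuous => t /H /dF [].
have F0 : F 0 = f x by rewrite /F scale0r addr0.
have [h0|h0] := leP 0 h.
  have H (t : R) : t \in `[0, h] -> `|t| <= `|h|.
    by rewrite in_itv /= => /andP[t0 th]; rewrite !ger0_norm.
  have [c ch E] := @MVT_segment R F (fun t => 'D_v f (x + t *: v)) 0 h h0
    (fun t tI => dF t (H t (subset_itv_oo_cc tI))) (cF _ _ H).
  exists c; first exact: H.
  by rewrite -F0 -[f (x + h *: v)]/(F h) E subr0 mulrC.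
have H (t : R) : t \in `[h, 0] -> `|t| <= `|h|.
  by rewrite in_itv /= => /andP[t0 th]; rewrite !ler0_norm ?lerN2 // ltW.
have [c ch E] := @MVT_segment R F (fun t => 'D_v f (x + t *: v)) h 0 (ltW h0)
  (fun t tI => dF t (H t (subset_itv_oo_cc tI))) (cF _ _ H).
exists c; first exact: H.
by rewrite -F0 -[f (x + h *: v)]/(F h) -opprB E sub0r mulrN opprK mulrC.
Qed.

Lemma norm_delta_mx_le1 n (a : 'I_n) : `|delta_mx 0 a : 'rV[R]_n| <= 1.
Proof.
apply: mx_norm_leP => // i j; rewrite mxE.
by case: (_ && _); rewrite ?normr1 ?normr0.
Qed.

Lemma norm_scale_delta n (a : 'I_n) t : `|t *: delta_mx 0 a : 'rV[R]_n| <= `|t|.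
Proof. by rewrite normrZ ler_piMr // norm_delta_mx_le1. Qed.

(* Telescoping over the coordinates reduces this to the mean value theorem on lines. *)
Lemma C1_taylor n (U : set 'rV[R]_n) (f : 'rV[R]_n -> R) (x : 'rV[R]_n) :
  open U -> U x -> Ck_on 1 U f ->
  forall e : R, 0 < e -> exists2 d : R, 0 < d & forall h : 'rV[R]_n, `|h| < d ->
    `|f (x + h) - f x - \sum_a h 0 a * pderiv a f x| <= e * `|h|.
Proof.
move=> oU Ux [_ C1] e e0.
(* There are [n] increments, each to be controlled within [e']; the successor avoids a division by
   zero when [n = 0]. *)
pose e' := e / n.+1%:R.
have e'0 : 0 < e' by rewrite divr_gt0.
have [d0 d00 dU] := open_rV_ball oU Ux.
have /choice[dd Hdd] : forall a : 'I_n, exists d : R, 0 < d /\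
    forall y, `|y - x| < d -> `|pderiv a f y - pderiv a f x| < e'.
  move=> a; have [_ [cf _]] := C1 a.
  by have /continuous_rVP /(_ _ e'0) [d ? ?] := cf x Ux; exists d.
pose d := \big[Num.min/d0]_a dd a.
have d_gt0 : 0 < d by apply: lt_bigmin => // a _; have [] := Hdd a.
exists d => // h hd.
(* The path from [0] to [h] that switches on one coordinate at a time; each leg is parallel to an
   axis and stays within [|h|]. *)
pose tr k := \row_(j < n) (if (j < k)%N then h 0 j else 0).
have tr0 : tr 0%N = 0 by apply/rowP => j; rewrite !mxE.
have trn : tr n = h by apply/rowP => j; rewrite !mxE ltn_ord.
have trS (k : 'I_n) : tr k.+1 = tr k + h 0 k *: delta_mx 0 k.
  apply/rowP => j; rewrite !mxE eqxx /= ltnS leq_eqVlt -val_eqE.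
  by case: ltngtP => //= jk; rewrite ?mulr0 ?addr0 ?mulr1 ?add0r //; congr (h _ _); exact: val_inj.
have small (k : 'I_n) t : `|t| <= `|h 0 k| -> `|tr k + t *: delta_mx 0 k| <= `|h|.
  move=> th; apply: mx_norm_leP => // i j; rewrite !mxE ord1 eqxx /= -val_eqE.
  case: ltngtP => //= jk; rewrite ?mulr0 ?addr0 ?mulr1 ?add0r ?normr0 // ?mx_entry_le //.
  exact: (le_trans th (mx_entry_le _ _ _)).
have tel : f (x + h) - f x = \sum_(k < n) (f (x + tr k.+1) - f (x + tr k)).
  rewrite -(big_mkord predT (fun k => f (x + tr k.+1) - f (x + tr k))).
  by rewrite telescope_sumr // trn tr0 addr0.
rewrite tel -sumrB (le_trans (ler_norm_sum _ _ _)) //.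
apply: (@le_trans _ _ (\sum_(k < n) e' * `|h|)); last first.
  rewrite sumr_const card_ord -mulr_natr mulrAC ler_wpM2r //.
  by rewrite /e' mulrAC -mulrA ler_piMr ?(ltW e0) // ler_pdivrMr // mul1r ler_nat.
apply: ler_sum => k _.
have near_x t : `|t| <= `|h 0 k| -> `|x + tr k + t *: delta_mx 0 k - x| < d.
  by move=> /small; rewrite -[x + _ + _]addrA addrAC subrr add0r => /le_lt_trans; exact.
have dle : d <= d0 by exact: bigmin_le_id.
have [t th E] := @MVT_line n f (x + tr k) (delta_mx 0 k) (h 0 k) (fun t th =>
  (C1 k).1 _ (dU _ (lt_le_trans (near_x t th) dle))).
rewrite trS addrA E -mulrBr normrM mulrC ler_pM // ?mx_entry_le //.
apply/ltW/(Hdd k).2/(lt_le_trans (near_x t th)).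
exact: bigmin_le_cond.
Qed.

(** Differentiability is phrased through the chosen differential ['d f x]; uniqueness of a
    continuous linear approximation identifies it with [L]. *)
Lemma differentiable_approx (V W : normedModType R) (f : V -> W) (x : V)
    (L : {linear V -> W}) : continuous L ->
  (forall e : R, 0 < e -> exists2 d : R, 0 < d & forall h : V, `|h| < d ->
    `|f (x + h) - f x - L h| <= e * `|h|) ->
  differentiable f x.
Proof.
move=> Lc H.
have T : f \o shift x = cst (f x) + L +o_ 0 id.
  apply/eqaddoP => e e0; have [d d0 Hd] := H e e0.
  apply/nbhs_ballP; exists d => //= h; rewrite -ball_normE /= sub0r normrN => hd.
  by have := Hd h hd; rewrite [x + h]addrC -addrA -opprD.
by apply/diff_locallyP; rewrite (diff_unique Lc T).
Qed.

Lemma C1_differentiable n (U : set 'rV[R]_n) (f : 'rV[R]_n -> R) (x : 'rV[R]_n) :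
  open U -> U x -> Ck_on 1 U f -> differentiable f x.
Proof.
move=> oU Ux C1f.
have lin : linear (fun h : 'rV[R]_n => \sum_a h 0 a * pderiv a f x).
  move=> k u v; rewrite scaler_sumr -big_split /=; apply: eq_bigr => a _.
  by rewrite !mxE mulrDl scalerAl.
pose L0 := GRing.isLinear.Build _ _ _ _ _ lin.
pose L : {linear 'rV[R]_n -> R} := HB.pack (fun h : 'rV[R]_n => \sum_a h 0 a * pderiv a f x) L0.
have Lc : continuous L.
  move=> y; apply: (@cvg_sumR _ _ (nbhs y) (nbhs_filter y) _
    (fun a (h : 'rV[R]_n) => h 0 a * pderiv a f x)) => a.
  by apply: cvgMl; exact: coord_continuous.
apply: (differentiable_approx (L := L) Lc) => e e0.
by have [d d0 Hd] := C1_taylor oU Ux C1f e0; exists d => // h hd; exact: Hd.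
Qed.

(* The second difference of [f] along [a] and [b] is symmetric in [a] and [b]. *)
Lemma pderivC n (U : set 'rV[R]_n) (f : 'rV[R]_n -> R) (x : 'rV[R]_n) a b :
  open U -> U x -> Ck_on 2 U f ->
  pderiv a (pderiv b f) x = pderiv b (pderiv a f) x.
Proof.
move=> oU Ux [_ C2].
suff H (i j : 'I_n) (e : R) : 0 < e -> exists2 d : R, 0 < d & forall h : R, `|h| < d ->
    `|(f (x + h *: delta_mx 0 i + h *: delta_mx 0 j) - f (x + h *: delta_mx 0 i)
     - (f (x + h *: delta_mx 0 j) - f x)) - h ^+ 2 * pderiv j (pderiv i f) x| <= h ^+ 2 * e.
  (* For one small positive [h], both mixed derivatives lie within [e / 2] of the same second
     difference divided by [h ^+ 2]. *)
  apply/eqP; rewrite -subr_eq0 -normr_le0; apply/ler_addgt0Pl => e e0.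
  have e20 : 0 < e / 2 by rewrite divr_gt0.
  have [d d0 Hd] := H b a _ e20; have [d' d'0 Hd'] := H a b _ e20.
  pose h := Num.min d d' / 2.
  have m0 : 0 < Num.min d d' by rewrite lt_min d0.
  have h0 : 0 < h by rewrite divr_gt0.
  have hd : `|h| < Num.min d d' by rewrite gtr0_norm // /h ltr_pdivrMr // mulrC ltr_pMl // ltr1n.
  have Hm1 : Num.min d d' <= d by rewrite ge_min lexx.
  have Hm2 : Num.min d d' <= d' by rewrite ge_min lexx orbT.
  have h1 := Hd h (lt_le_trans hd (Hm1)).
  have h2 := Hd' h (lt_le_trans hd (Hm2)).
  have hh : 0 < h ^+ 2 by rewrite exprn_gt0.
  move: h1 h2; rewrite [x + _ + _]addrAC.
  set F11 := f (_ + _ + _); set F01 := f (x + h *: delta_mx 0 a); set F10 := f (x + h *: delta_mx 0 b).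
  have -> : F11 - F01 - (F10 - f x) = F11 - F10 - (F01 - f x) by ring.
  move=> h1 h2; rewrite addr0 -(ler_pM2l hh) -[X in X * `|_|](gtr0_norm hh) -normrM.
  have subD (A B D : R) : A - B = (D - B) - (D - A) by rewrite opprB [RHS]addrC addrA subrK.
  rewrite mulrBr (subD _ _ (F11 - F10 - (F01 - f x))).
  apply: (le_trans (ler_normB _ _)).
  by rewrite [e]splitr mulrDr; exact: lerD h2 h1.
move=> e0.
have [C1i [_ C2i]] := C2 i.
have [C1ij [cij _]] := C2i j.
have /continuous_rVP /(_ e e0) [d d0 Hd] := cij x Ux.
have [d1 d10 dU] := open_rV_ball oU Ux.
have m0 : 0 < Num.min d d1 by rewrite lt_min d0.
exists (Num.min d d1 / 2); first by rewrite divr_gt0.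
move=> h hd.
have hd2 : `|h| + `|h| < Num.min d d1 by rewrite -mulr2n -mulr_natr -ltr_pdivlMr.
have close s t : `|s| <= `|h| -> `|t| <= `|h| ->
    `|x + s *: delta_mx 0 i + t *: delta_mx 0 j - x| < Num.min d d1.
  move=> sh th; rewrite -[x + _ + _]addrA addrAC subrr add0r; apply: le_lt_trans hd2.
  by apply: (le_trans (ler_normD _ _)); rewrite lerD // (le_trans (norm_scale_delta _ _)).
have inU s t : `|s| <= `|h| -> `|t| <= `|h| ->
    U (x + s *: delta_mx 0 i + t *: delta_mx 0 j).
  by move=> sh th; apply/dU/(lt_le_trans (close s t sh th)); rewrite ge_min lexx orbT.
have inU0 s : `|s| <= `|h| -> U (x + s *: delta_mx 0 i).
  by move=> sh; have := inU s 0 sh; rewrite normr0 scale0r addr0; apply.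
(* The second difference is the increment of [phi] along [i]. The mean value theorem along [i], then
   along [j], turns it into [h ^+ 2] times the mixed derivative at a point close to [x]. *)
pose phi y := f (y + h *: delta_mx 0 j) - f y.
have dsh s : `|s| <= `|h| -> derivable (fun y => f (y + h *: delta_mx 0 j)) (x + s *: delta_mx 0 i) (delta_mx 0 i)
   /\ 'D_(delta_mx 0 i) (fun y => f (y + h *: delta_mx 0 j)) (x + s *: delta_mx 0 i) =
      pderiv i f (x + s *: delta_mx 0 i + h *: delta_mx 0 j).
  move=> sh; have := C1i _ (inU s h sh (lexx _)).
  rewrite /derivable /pderiv /derive /=; set y := x + _ => df.
  suff -> : (fun h0 => h0^-1 *: (f (h0 *: delta_mx 0 i + y + h *: delta_mx 0 j) - f (y + h *: delta_mx 0 j))) =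
    (fun h0 => h0^-1 *: (f (h0 *: delta_mx 0 i + (y + h *: delta_mx 0 j)) - f (y + h *: delta_mx 0 j))) by [].
  by apply/funext => k; rewrite -[_ + y + _]addrA.
have [s sh Es] := @MVT_line n phi x (delta_mx 0 i) h (fun s sh =>
  derivableB (dsh s sh).1 (C1i _ (inU0 s sh))).
rewrite -[X in `|X - _|]/(phi (x + h *: delta_mx 0 i) - phi x) Es.
rewrite deriveB; [|exact: (dsh s sh).1|exact: C1i (inU0 s sh)].
rewrite (dsh s sh).2 -/(pderiv i f _).
have [t th ->] := @MVT_line n (pderiv i f) (x + s *: delta_mx 0 i) (delta_mx 0 j) h
  (fun t th => C1ij _ (inU s t sh th)).
rewrite -/(pderiv j _ _) mulrA -expr2 -mulrBr normrM ger0_norm ?sqr_ge0 //.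
rewrite ler_wpM2l ?sqr_ge0 // ltW // Hd // (lt_le_trans (close s t sh th)) //.
by rewrite ge_min lexx.
Qed.

End Calculus.

(** * Closure properties of C^k functions *)

Section CkAlgebra.
Context {R : realType} {n : nat}.
Implicit Types (U V : set 'rV[R]_n) (f g u : 'rV[R]_n -> R) (x : 'rV[R]_n) (a : 'I_n).

Lemma pderivD f g a x : derivable f x (delta_mx 0 a) -> derivable g x (delta_mx 0 a) ->
  pderiv a (fun y => f y + g y) x = pderiv a f x + pderiv a g x.
Proof. by move=> df dg; rewrite /pderiv -deriveD. Qed.

Lemma pderivM f g a x : derivable f x (delta_mx 0 a) -> derivable g x (delta_mx 0 a) ->
  pderiv a (fun y => f y * g y) x = pderiv a f x * g x + f x * pderiv a g x.
Proof. by move=> df dg; rewrite /pderiv (deriveM df dg) addrC; congr (_ + _); exact: mulrC. Qed.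

Lemma pderiv_cst (c : R) a x : pderiv a (fun=> c) x = 0.
Proof. exact: derive_cst. Qed.

Lemma is_derive_coord (c : 'I_n) a x :
  is_derive x (delta_mx 0 a) (fun y : 'rV[R]_n => y 0 c) ((a == c)%:R).
Proof.
have d : derivable id x (delta_mx 0 a : 'rV[R]_n) by exact: derivable_id.
apply: DeriveDef; first exact: (derivable_mxP _ _ _).1 d 0 c.
have := derive_mx d; rewrite derive_id => /matrixP /(_ 0 c).
by rewrite !mxE eqxx /= eq_sym => ->.
Qed.

Lemma pderiv_coord (c : 'I_n) a x : pderiv a (fun y => y 0 c) x = (a == c)%:R.
Proof. by have [_] := is_derive_coord c a x. Qed.

Lemma near_open_eq U f g x : open U -> U x -> (forall y, U y -> f y = g y) ->
  \forall y \near x, f y = g y.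
Proof.
move=> oU Ux fg; have : nbhs x U by exact: open_nbhs_nbhs.
by apply: filterS => y; exact: fg.
Qed.

Lemma pderiv_eq_on U f g a x : open U -> U x -> (forall y, U y -> f y = g y) ->
  pderiv a f x = pderiv a g x.
Proof. by move=> oU Ux fg; apply/near_eq_derive/(near_open_eq oU Ux fg). Qed.

Lemma Ck_on_eq k U f g : open U -> (forall y, U y -> f y = g y) ->
  Ck_on k U f -> Ck_on k U g.
Proof.
move=> oU; have cg f1 g1 x : (forall y, U y -> f1 y = g1 y) -> U x ->
    {for x, continuous f1} -> {for x, continuous g1}.
  move=> fg Ux fc; change (g1 y @[y --> x] --> g1 x); rewrite -(fg x Ux).
  have H : \forall y \near x, f1 y = g1 y := near_open_eq oU Ux fg.
  exact: (cvg_trans (@near_eq_cvg _ _ _ (nbhs_filter x) _ _ H) fc).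
elim: k f g => [|k IH] f g fg [fc fk].
  by split=> // x Ux; exact: cg fg Ux (fc x Ux).
split=> [x Ux|a]; first exact: cg fg Ux (fc x Ux).
have [fd fk'] := fk a; split.
  by move=> x Ux; apply: near_eq_derivable (fd x Ux); exact: near_open_eq oU Ux fg.
by apply: IH fk' => y Uy; exact: pderiv_eq_on oU Uy fg.
Qed.

Lemma Ck_on_sub k U V f : V `<=` U -> Ck_on k U f -> Ck_on k V f.
Proof.
move=> VU; elim: k f => [|k IH] f [fc fk]; split=> //.
- by move=> x /VU; exact: fc.
- by move=> x /VU; exact: fc.
move=> a; have [fd fk'] := fk a; split; last exact: IH.
by move=> x /VU; exact: fd.
Qed.

(** Each clause of [Ck_on] is a condition at points on a total function, so the witness set may
    change with the point. This lets the bump function be described by different formulas on and off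
    its chart. *)
Lemma Ck_on_local k U f :
  (forall x, U x -> exists2 V, V x & Ck_on k V f) -> Ck_on k U f.
Proof.
elim: k f => [|k IH] f H.
  by split=> // x /H[V Vx [fc _]]; exact: fc.
split=> [x /H[V Vx [fc _]]|a]; first exact: fc.
split=> [x /H[V Vx [_ /(_ a)[fd _]]]|]; first exact: fd.
by apply: IH => x /H[V Vx [_ /(_ a)[]]] _; exists V.
Qed.

Lemma Ck_onS k U f : Ck_on k.+1 U f -> Ck_on k U f.
Proof.
elim: k f => [|k IH] f [fc fk]; split=> // a.
by have [fd fk'] := fk a; split=> //; exact: IH.
Qed.

Lemma Ck_on_le k l U f : (k <= l)%N -> Ck_on l U f -> Ck_on k U f.
Proof. by move/subnKC <-; elim: (l - k)%N => [|m IH]; rewrite ?addn0 // addnS => /Ck_onS. Qed.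

Lemma Ck_on_continuous k U f x : Ck_on k U f -> U x -> {for x, continuous f}.
Proof. by case: k => [|k] [fc _]; exact: fc. Qed.

Lemma Ck_on_derivable k U f a x : Ck_on k.+1 U f -> U x -> derivable f x (delta_mx 0 a).
Proof. by move=> [_ /(_ a)[+ _]]; exact. Qed.

Lemma Ck_on_pderiv k U f a : Ck_on k.+1 U f -> Ck_on k U (pderiv a f).
Proof. by move=> [_ /(_ a)[]]. Qed.

Lemma Ck_on_cst k U (c : R) : Ck_on k U (fun=> c).
Proof.
elim: k c => [|k IH] c; split=> //; try by move=> x _; exact: cst_continuous.
move=> a; split; first by move=> x _; exact: derivable_cst.
suff -> : pderiv a (fun=> c) = (fun=> 0) by exact: IH.
by apply/funext => x; exact: pderiv_cst.
Qed.

Lemma Ck_on_coord k U (c : 'I_n) : Ck_on k U (fun x => x 0 c).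
Proof.
case: k => [|k]; split=> //; try by move=> x _; exact: coord_continuous.
move=> a; split; first by move=> x _; have [] := is_derive_coord c a x.
suff -> : pderiv a (fun x : 'rV[R]_n => x 0 c) = (fun=> (a == c)%:R) by exact: Ck_on_cst.
by apply/funext => x; exact: pderiv_coord.
Qed.

Lemma Ck_onD k U f g : open U -> Ck_on k U f -> Ck_on k U g ->
  Ck_on k U (fun x => f x + g x).
Proof.
move=> oU; elim: k f g => [|k IH] f g fk gk; split=> //;
  try by move=> x Ux; exact: (continuousD (Ck_on_continuous fk Ux) (Ck_on_continuous gk Ux)).
move=> a; split.
  by move=> x Ux; apply: derivableD; [exact: Ck_on_derivable fk Ux|exact: Ck_on_derivable gk Ux].
apply: (@Ck_on_eq _ _ (fun x => pderiv a f x + pderiv a g x)) => // [x Ux|].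
  by rewrite pderivD //; [exact: Ck_on_derivable fk Ux|exact: Ck_on_derivable gk Ux].
by apply: IH; exact: Ck_on_pderiv.
Qed.

Lemma Ck_onM k U f g : open U -> Ck_on k U f -> Ck_on k U g ->
  Ck_on k U (fun x => f x * g x).
Proof.
move=> oU; elim: k f g => [|k IH] f g fk gk; split=> //;
  try by move=> x Ux; exact: (continuousM (Ck_on_continuous fk Ux) (Ck_on_continuous gk Ux)).
move=> a; split.
  by move=> x Ux; apply: derivableM; [exact: Ck_on_derivable fk Ux|exact: Ck_on_derivable gk Ux].
apply: (@Ck_on_eq _ _ (fun x => pderiv a f x * g x + f x * pderiv a g x)) => // [x Ux|].
  by rewrite pderivM //; [exact: Ck_on_derivable fk Ux|exact: Ck_on_derivable gk Ux].
apply: Ck_onD => //; apply: IH.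
- exact: Ck_on_pderiv.
- exact: Ck_onS.
- exact: Ck_onS.
- exact: Ck_on_pderiv.
Qed.

Lemma Ck_on_sum (I : Type) (r : seq I) k U (f : I -> 'rV[R]_n -> R) : open U ->
  (forall i, Ck_on k U (f i)) -> Ck_on k U (fun x => \sum_(i <- r) f i x).
Proof.
move=> oU fk; elim: r => [|i r IH].
  by apply: (@Ck_on_eq _ _ (fun=> 0)) => // [x _|]; [rewrite big_nil|exact: Ck_on_cst].
apply: (@Ck_on_eq _ _ (fun x => f i x + \sum_(j <- r) f j x)) => // [x _|].
  by rewrite big_cons.
exact: Ck_onD.
Qed.

Lemma is_pderiv_comp (F : R -> R) u (dF : R) a x : differentiable u x ->
  is_derive (u x) 1 F dF ->
  derivable (F \o u) x (delta_mx 0 a) /\ pderiv a (F \o u) x = dF * pderiv a u x.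
Proof.
move=> du dFx; have dFd : differentiable F (u x) by apply/derivable1_diffP; have [] := dFx.
have dc : differentiable (F \o u) x by exact: differentiable_comp.
split; first exact: diff_derivable.
rewrite /pderiv deriveE // diff_comp //= -[X in 'd F _ X]deriveE //.
have -> : 'd F (u x) ('D_(delta_mx 0 a) u x) = 'D_(delta_mx 0 a) u x *: 'd F (u x) 1.
  by rewrite -linearZ /= [_ *: 1]mulr1.
by rewrite -[in X in _ *: X = _]deriveE // derive_val mulrC.
Qed.

(** The induction on [k] keeps [m] general: a derivative of [F m \o u] involves the members [j1 m]
    and [j2 m], to which the induction hypothesis applies. *)
Lemma Ck_on_comp_family (F : nat -> R -> R) (c1 c2 : nat -> R) (j1 j2 : nat -> nat) k U u :
  (forall m (s : R), is_derive s 1 (F m) (c1 m * F (j1 m) s + c2 m * F (j2 m) s)) ->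
  open U -> Ck_on k U u -> forall m, Ck_on k U (F m \o u).
Proof.
move=> dF oU.
have Fc m : continuous (F m).
  by move=> s; apply: differentiable_continuous; apply/derivable1_diffP; have [] := dF m s.
elim: k => [|k IH] uk m; split=> //;
  try by move=> x Ux; apply: continuous_comp; [exact: Ck_on_continuous uk Ux|exact: Fc].
move=> a.
have D x : U x -> _ := fun Ux => is_pderiv_comp a
  (C1_differentiable oU Ux (@Ck_on_le 1 k.+1 _ _ (ltn0Sn k) uk)) (dF m (u x)).
split; first by move=> x /D[].
apply: (@Ck_on_eq _ _ (fun x => (c1 m * F (j1 m) (u x) + c2 m * F (j2 m) (u x)) * pderiv a u x)) => //.
  by move=> x /D[_ ->].
have IHu := IH (Ck_onS uk).
apply: Ck_onM => //; last exact: Ck_on_pderiv.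
by apply: Ck_onD => //; apply: Ck_onM => //; [exact: Ck_on_cst|exact: (IHu (j1 m))|
  exact: Ck_on_cst|exact: (IHu (j2 m))].
Qed.

End CkAlgebra.

(** * The chain rule in several variables *)

Section ChainRule.
Context {R : realType} {n m : nat}.
Implicit Types (psi : 'rV[R]_n -> 'rV[R]_m).

Lemma differentiable_rV psi x :
  (forall c, differentiable (fun y => psi y 0 c) x) -> differentiable psi x.
Proof.
move=> d; have -> : psi = \sum_(c < m) (fun y => psi y 0 c *: (delta_mx 0 c : 'rV[R]_m)).
  by apply/funext => y; rewrite fct_sumE {1}[psi y]row_sum_delta.
by apply: differentiable_sum => c; exact: differentiableZl.
Qed.

Lemma jacobian_entry psi x a c : differentiable psi x ->
  'J psi x a c = pderiv a (fun y => psi y 0 c) x.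
Proof.
move=> d; rewrite /jacobian /lin1_mx mxE -deriveE // derive_mx ?mxE //.
exact: diff_derivable.
Qed.

Lemma pderiv_chain psi (f : 'rV[R]_m -> R) x a :
  differentiable psi x -> differentiable f (psi x) ->
  pderiv a (f \o psi) x = \sum_c 'J psi x a c * pderiv c f (psi x).
Proof.
move=> dpsi df; rewrite /pderiv deriveE; last exact: differentiable_comp.
rewrite diff_comp //= -[X in 'd f _ X]deriveE // [X in 'd f _ X]row_sum_delta linear_sum /=.
apply: eq_bigr => c _; rewrite linearZ /= -deriveE // jacobian_entry //.
rewrite derive_mx; last exact: diff_derivable.
by rewrite mxE.
Qed.

End ChainRule.

(** * The functions [s^-m exp(-b/s)], extended by zero *)

Section Flat.
Context {R : realType}.

(* The derivative of [flat b m] is a combination of [flat b m.+1] and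
   [flat b m.+2], so smoothness is proved for the whole family at once. *)
Definition flat (b : R) (m : nat) (s : R) : R :=
  if 0 < s then s^-1 ^+ m * expR (- b * s^-1) else 0.

Lemma flat_le0 b m s : s <= 0 -> flat b m s = 0.
Proof. by move=> s0; rewrite /flat ltNge s0. Qed.

Lemma flat_gt0 b m s : 0 < s -> 0 < flat b m s.
Proof. by move=> s0; rewrite /flat s0 mulr_gt0 ?expR_gt0 // exprn_gt0 // invr_gt0. Qed.

Lemma flat_ge0 b m s : 0 <= flat b m s.
Proof. by have [s0|s0] := leP s 0; [rewrite flat_le0|exact/ltW/flat_gt0]. Qed.

Lemma flatD b m k s : 0 < s -> flat b (m + k) s = s^-1 ^+ k * flat b m s.
Proof. by move=> s0; rewrite /flat s0 addnC exprD mulrA. Qed.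

Lemma expRN_le (y : R) : 0 < y -> expR (- y) <= y^-1.
Proof.
move=> y0; rewrite expRN lef_pV2 ?posrE ?expR_gt0 //.
by apply: le_trans (expR_ge1Dx y); rewrite lerDr.
Qed.

(** With [N = m + 2] and [y = b / (s N)], [exp(-b/s) = exp(-y)^N <= y^-N = (s N / b)^N]; the factor
    [s^-m] leaves [s^2]. The exponent 2 is what makes the derivative at 0 vanish. *)
Lemma flat_quadratic b m : 0 < b ->
  exists2 C : R, 0 < C & forall s, `|flat b m s| <= C * s ^+ 2.
Proof.
move=> b0; set N := m.+2.
have N0 : 0 < N%:R :> R by [].
exists ((N%:R / b) ^+ N); first by rewrite exprn_gt0 // divr_gt0.
move=> s; have [s0|s0] := leP s 0.
  by rewrite flat_le0 // normr0 mulr_ge0 ?sqr_ge0 // exprn_ge0 // divr_ge0 // ltW.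
rewrite ger0_norm ?flat_ge0 // /flat s0.
have y0 : 0 < b / s / N%:R by rewrite !divr_gt0.
have -> : - b * s^-1 = - (b / s / N%:R) * N%:R by rewrite !mulNr divfK ?gt_eqF.
rewrite mulrC expRM_natr exprVn ler_pdivrMr ?exprn_gt0 //.
apply: (@le_trans _ _ ((b / s / N%:R)^-1 ^+ N)).
  by rewrite lerXn2r ?nnegrE ?expR_ge0 ?invr_ge0 ?(ltW y0) //; exact: expRN_le.
rewrite -[X in _ <= X]mulrA -exprD add2n -/N -exprMn !invfM !invrK.
by rewrite [_ * N%:R]mulrC mulrA.
Qed.

Lemma is_derive0_quadratic (f : R -> R) (C : R) : 0 < C ->
  (forall s, `|f s| <= C * s ^+ 2) -> is_derive (0 : R) 1 f 0.
Proof.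
move=> C0 fC; have f0 : f 0 = 0.
  by apply/normr0_eq0/le_anti; rewrite normr_ge0 andbT (le_trans (fC 0)) // expr0n mulr0.
suff H : h^-1 *: ((f \o shift 0) (h *: 1) - f 0) @[h --> (0 : R)^'] --> (0 : R).
  by apply: DeriveDef; [apply/cvg_ex; exists 0|exact: cvg_lim H].
apply/cvgrPdist_le => e e0; near=> h.
have h0 : h != 0 by near: h; exact: nbhs_dnbhs_neq.
have he : `|h| < e / C by near: h; apply: dnbhs0_lt; exact: divr_gt0.
rewrite sub0r normrN f0 subr0 /= addr0 [h *: 1]mulr1 normrM normfV.
rewrite ler_pdivrMl ?normr_gt0 //; apply: le_trans (fC h) _.
rewrite -[h ^+ 2]real_normK ?num_real // expr2 mulrCA ler_wpM2l // mulrC.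
by rewrite -ler_pdivlMr // ltW.
Unshelve. all: by end_near. Qed.

Lemma is_derive_flat b m (s : R) : 0 < b ->
  is_derive s 1 (flat b m) (- m%:R * flat b m.+1 s + b * flat b m.+2 s).
Proof.
move=> b0; have [s0|s0|->] := ltgtP s 0.
- rewrite !flat_le0 ?(ltW s0) // !mulr0 addr0.
  have H : is_derive s (1 : R) (cst (0 : R) : R -> R) 0 by exact: is_derive_cst.
  apply: near_eq_is_derive H.
  by near=> t; rewrite /= flat_le0 // ltW //; near: t; exact: lt_nbhsl.
(* For [s > 0], the function is [w^m exp(-b w)] at [w = 1/s]; the inner derivative [- w^2] raises
   the exponents. *)
- have dV : is_derive s 1 (fun t : R => t^-1) (- s^-1 ^+ 2).
    have := @is_deriveV R (fun t : R => t) s 1 1 (lt0r_neq0 s0) (is_derive_id (s : R) (1 : R)).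
    by move=> H; apply: is_derive_eq; rewrite /= exprVn [_ *: 1]mulr1.
  have dh (w : R) : is_derive w 1 (fun w => w ^+ m * expR (- b * w))
      ((m%:R * w ^+ m.-1 - b * w ^+ m) * expR (- b * w)).
    have d1 : is_derive w 1 (fun w : R => w ^+ m) (m%:R * w ^+ m.-1).
      by apply: DeriveDef; [exact: exprn_derivable|rewrite exp_derive /GRing.scale /= mulr1].
    have d2 : is_derive w 1 (fun w : R => expR (- b * w)) (expR (- b * w) * (- b)).
      apply: (@is_derive1_comp _ expR (fun w => - b * w) w).
      have := @is_deriveZ R R R (fun w => w) (- b) w 1 1 (is_derive_id w 1).
      by move=> H; apply: is_derive_eq; rewrite [_ *: _]mulr1.
    have := is_deriveM d1 d2.
    by move=> H; apply: is_derive_eq; rewrite /GRing.scale /=; ring.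
  have H := @is_derive1_comp R _ (fun t : R => t^-1) s _ _ (dh s^-1) dV.
  have nE : \forall t \near s, ((fun w => w ^+ m * expR (- b * w)) \o (fun t : R => t^-1)) t = flat b m t.
    by near=> t; rewrite /= /flat ifT //; near: t; exact: lt_nbhsr.
  have H' := near_eq_is_derive nE H.
  apply: is_derive_eq; rewrite /flat s0.
  (* At [m = 0] the truncated exponent [m.-1] is harmless: its coefficient [m] is zero. *)
  case: m {dh H H' nE} => [|m] /=; first by ring.
  by rewrite !exprS; ring.
- have [C C0 HC] := flat_quadratic m b0.
  by rewrite !flat_le0 // !mulr0 addr0; exact: is_derive0_quadratic C0 HC.
Unshelve. all: by end_near. Qed.

End Flat.

(** * Positive semidefinite matrices and trace inequalities *)

Section SymmetricForms.
Context {R : realType} {n : nat}.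
Implicit Types (A P Q g T H K J : 'M[R]_n) (v w omega : 'rV[R]_n).

Definition psd A := forall v, 0 <= quadform A v.
Definition posdef A := forall v, v != 0 -> 0 < quadform A v.
Definition entry_sum A := \sum_a \sum_b `|A a b|.
Definition sqnorm v := \sum_a v 0 a ^+ 2.

Lemma quadformE A v : quadform A v = \sum_a \sum_b v 0 a * A a b * v 0 b.
Proof.
rewrite /quadform mxE exchange_big /=; apply: eq_bigr => b _.
by rewrite !mxE mulr_suml.
Qed.

Lemma quadformDl A Q v : quadform (A + Q) v = quadform A v + quadform Q v.
Proof. by rewrite /quadform mulmxDr mulmxDl mxE. Qed.

Lemma quadformZl c A v : quadform (c *: A) v = c * quadform A v.
Proof. by rewrite /quadform -scalemxAr -scalemxAl mxE. Qed.

Lemma quadform1 v : quadform 1%:M v = sqnorm v.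
Proof. by rewrite /quadform mulmx1 mxE; apply: eq_bigr => a _; rewrite mxE expr2. Qed.

Lemma quadform_congr A Q v : quadform (Q *m A *m Q^T) v = quadform A (v *m Q).
Proof. by rewrite /quadform trmx_mul !mulmxA. Qed.

Lemma quadform_rank1 w v : quadform (w^T *m w) v = (v *m w^T) 0 0 ^+ 2.
Proof.
rewrite /quadform mulmxA -mulmxA mxE big_ord1 expr2; congr (_ * _).
by have -> : w *m v^T = (v *m w^T)^T; [rewrite trmx_mul trmxK|rewrite mxE].
Qed.

Lemma quadformB A v w (t : R) : A^T = A ->
  quadform A (v - t *: w) =
  quadform A v - 2 * t * (v *m A *m w^T) 0 0 + t ^+ 2 * quadform A w.
Proof.
move=> As; have E : (w *m A *m v^T) 0 0 = (v *m A *m w^T) 0 0.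
  by have -> : w *m A *m v^T = (v *m A *m w^T)^T;
    [rewrite !trmx_mul trmxK As mulmxA|rewrite mxE].
have Et : (v - t *: w)^T = v^T - t *: w^T by rewrite linearB linearZ.
rewrite /quadform Et !mulmxBl !mulmxBr -!scalemxAl -!scalemxAr.
rewrite !mxE in E *; rewrite E; ring.
Qed.

Lemma sqnorm_ge0 v : 0 <= sqnorm v.
Proof. by apply: sumr_ge0 => a _; rewrite sqr_ge0. Qed.

Lemma sqnorm_eq0 v : sqnorm v = 0 -> v = 0.
Proof.
move=> /eqP; rewrite psumr_eq0 => [/allP H|a _]; last exact: sqr_ge0.
by apply/rowP => a; rewrite mxE; have := H a (mem_index_enum _); rewrite /= sqrf_eq0 => /eqP.
Qed.

Lemma entry_sum_ge0 A : 0 <= entry_sum A.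
Proof. by apply: sumr_ge0 => a _; apply: sumr_ge0. Qed.

Lemma sqr_le_sqnorm v a : v 0 a ^+ 2 <= sqnorm v.
Proof.
rewrite /sqnorm (bigD1 a) //= lerDl; apply: sumr_ge0 => b _; exact: sqr_ge0.
Qed.

Lemma normM_le_sqnorm v a b : `|v 0 a * v 0 b| <= sqnorm v.
Proof.
have h : `|v 0 a| * `|v 0 b| <= (`|v 0 a| ^+ 2 + `|v 0 b| ^+ 2) / 2.
  by have := sqr_ge0 (`|v 0 a| - `|v 0 b|); nra.
rewrite normrM (le_trans h) // ler_pdivrMr // mulr_natr mulr2n.
by rewrite !real_normK ?num_real // lerD // sqr_le_sqnorm.
Qed.

Lemma quadform_norm_le A v : `|quadform A v| <= entry_sum A * sqnorm v.
Proof.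
rewrite quadformE (le_trans (ler_norm_sum _ _ _)) // mulr_suml ler_sum // => a _.
rewrite (le_trans (ler_norm_sum _ _ _)) // mulr_suml ler_sum // => b _.
by rewrite mulrAC normrM mulrC ler_wpM2l // normM_le_sqnorm.
Qed.

Lemma quadform_delta A a : quadform A (delta_mx 0 a) = A a a.
Proof. by rewrite /quadform -rowE trmx_delta -colE !mxE. Qed.

Lemma psd_diag_ge0 A a : psd A -> 0 <= A a a.
Proof. by move=> /(_ (delta_mx 0 a)); rewrite quadform_delta. Qed.

(** At [e_a - e_b] and [e_a + e_b] the form takes the values [-2 A_ab] and [2 A_ab], both
    nonnegative. *)
Lemma psd_diag0 A : A^T = A -> psd A -> (forall a, A a a = 0) -> A = 0.
Proof.
move=> As Ap A0; apply/matrixP => a b; rewrite mxE.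
have E : ((delta_mx 0 a : 'rV[R]_n) *m A *m (delta_mx 0 b : 'rV[R]_n)^T) 0 0 = A a b.
  by rewrite -rowE trmx_delta -colE !mxE.
have := Ap (delta_mx 0 a - (1 : R) *: delta_mx 0 b).
have := Ap (delta_mx 0 a - (-1 : R) *: delta_mx 0 b).
by rewrite !quadformB // E !quadform_delta !A0; lra.
Qed.

Lemma trace_rank1 w Q : \tr (w^T *m w *m Q) = quadform Q w.
Proof. by rewrite -mulmxA mxtrace_mulC /quadform /mxtrace big_ord1. Qed.

(* Gaussian elimination removes one nonzero diagonal entry of [P] at a time,
   splitting off a nonnegative rank-one term. *)
Lemma psd_trace P Q : P^T = P -> psd P -> psd Q -> 0 <= \tr (P *m Q).
Proof.
move=> + + Qp; have [k] := ubnP #|[pred a | P a a != 0]|.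
elim: k P => // k IH P Pk Ps Pp.
have [a Pa|P0] := pickP [pred a | P a a != 0]; last first.
  rewrite (_ : P = 0) ?mul0mx ?mxtrace0 //; apply: psd_diag0 => // a.
  by have := P0 a => /= /negbT; rewrite negbK => /eqP.
have pa : 0 < P a a by rewrite lt_def psd_diag_ge0 // andbT; exact: Pa.
set p := P a a in pa; pose u := row a P.
have uE : delta_mx 0 a *m P = u by rewrite -rowE.
pose P' := P - p^-1 *: (u^T *m u).
have P's : P'^T = P' by rewrite /P' linearB /= linearZ /= trmx_mul trmxK Ps.
(* Completing the square in the coordinate [a]; it shows at once that [P'] is still positive
   semidefinite. *)
have P'q v : quadform P' v = quadform P (v - ((v *m u^T) 0 0 / p) *: delta_mx 0 a).
  have vP : v *m P *m (delta_mx 0 a)^T = v *m u^T by rewrite -mulmxA -uE trmx_mul Ps.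
  rewrite quadformB // quadform_delta -/p vP.
  rewrite /P' quadformDl -scaleNr quadformZl quadform_rank1.
  by field; rewrite gt_eqF.
have P'p : psd P' by move=> v; rewrite P'q.
have P'd c : P' c c = P c c - p^-1 * (P a c) ^+ 2.
  by rewrite !mxE big_ord1 !mxE expr2.
have -> : P = P' + p^-1 *: (u^T *m u) by rewrite subrK.
rewrite mulmxDl mxtraceD -scalemxAl mxtraceZ trace_rank1 addr_ge0 //; last first.
  by rewrite mulr_ge0 // invr_ge0 ltW.
have Pk' : leq #|[pred c | P c c != 0]| k by [].
apply: IH => //; apply: (leq_trans _ Pk').
(* The measure drops: entry [a] of the diagonal becomes zero, and a zero entry [P c c] cannot become
   nonzero, since [P' c c] would be [- P a c ^ 2 / p], which must be nonnegative. *)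
apply/proper_card/properP; split.
  apply/fintype.subsetP => c; rewrite !inE; apply: contraNneq => Pc0.
  have := psd_diag_ge0 c P'p; rewrite P'd Pc0 sub0r oppr_ge0 => h.
  rewrite oppr_eq0; apply/eqP/le_anti; rewrite h mulr_ge0 ?sqr_ge0 //.
  by rewrite invr_ge0 ltW.
exists a; rewrite !inE; first exact: Pa.
by rewrite P'd -/p negbK expr2 mulKf ?subrr // gt_eqF.
Qed.

Lemma posdef_psd A : posdef A -> psd A.
Proof.
move=> Ap v; have [->|v0] := eqVneq v 0; last exact/ltW/Ap.
by rewrite /quadform !mul0mx mxE.
Qed.

Lemma posdef_unitmx A : posdef A -> A \in unitmx.
Proof.
move=> Ap; rewrite unitmxE unitfE; apply/negP => /det0P[v v0 vA].
by have := Ap v v0; rewrite /quadform vA mul0mx mxE ltxx.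
Qed.

Section Metric.
Variable g : 'M[R]_n.
Hypotheses (gs : g^T = g) (gp : posdef g).
Let gu := posdef_unitmx gp.
Local Notation gi := (invmx g).

Lemma invmx_sym : gi^T = gi.
Proof. by rewrite trmx_inv gs. Qed.

Lemma quadform_invmx v : quadform gi v = quadform g (v *m gi).
Proof. by rewrite -quadform_congr invmx_sym mulVmx // mul1mx. Qed.

Lemma posdef_invmx : posdef gi.
Proof.
move=> v v0; rewrite quadform_invmx gp //; apply: contraNneq v0 => /(congr1 (mulmx^~ g)).
by rewrite mul0mx mulmxKV // => ->.
Qed.

(** A lower bound on the smallest eigenvalue without spectral theory. With [S = entry_sum gi],
    nonnegativity of [g] at [v - S^-1 v g^-1] reads [g(v) - 2 |v|^2 / S + g^-1(v) / S^2 >= 0], and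
    [g^-1(v) <= S |v|^2]. *)
Lemma sqnorm_le_quadform v : sqnorm v <= entry_sum gi * quadform g v.
Proof.
have [/sqnorm_eq0 ->|N0] := eqVneq (sqnorm v) 0.
  by rewrite -quadform1 /quadform !mul0mx mxE mulr0.
have v0 : v != 0.
  by apply: contraNneq N0 => ->; rewrite -quadform1 /quadform !mul0mx mxE.
have Np : 0 < sqnorm v by rewrite lt_def N0 sqnorm_ge0.
set S := entry_sum gi.
have qi : quadform gi v <= S * sqnorm v := le_trans (ler_norm _) (quadform_norm_le gi v).
have S0 : 0 < S.
  have h := lt_le_trans (posdef_invmx v0) qi; rewrite lt_def entry_sum_ge0 andbT.
  by apply: contraTneq h => ->; rewrite mul0r ltxx.
have := posdef_psd gp (v - S^-1 *: (v *m gi)).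
rewrite quadformB // -quadform_invmx trmx_mul invmx_sym -!mulmxA mulKVmx //.
have -> : (v *m v^T) 0 0 = sqnorm v by rewrite -quadform1 /quadform mulmx1.
move=> h; have h2 : S ^- 2 * quadform gi v <= S^-1 * sqnorm v.
  apply: le_trans (ler_wpM2l _ qi) _; first by rewrite invr_ge0 exprn_ge0 // ltW.
  by rewrite expr2 invfM mulrA -[_ * S]mulrA mulVf ?mulr1 // gt_eqF.
have h3 : S^-1 * sqnorm v <= quadform g v by rewrite exprVn in h; lra.
by rewrite -ler_pdivrMl.
Qed.

(** The inner product of tensors, with both indices of [T] raised. The raised matrix is positive
    semidefinite when [T] is, so [psd_trace] applies to it. *)
Definition pairing T H := \tr (gi *m T *m gi *m H).

Lemma raised_sym T : T^T = T -> (gi *m T *m gi)^T = gi *m T *m gi.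
Proof. by move=> Ts; rewrite !trmx_mul invmx_sym Ts mulmxA. Qed.

Lemma raised_quadform T v : quadform (gi *m T *m gi) v = quadform T (v *m gi).
Proof. by rewrite -quadform_congr invmx_sym. Qed.

Lemma raised_psd T : psd T -> psd (gi *m T *m gi).
Proof. by move=> Tp v; rewrite raised_quadform. Qed.

Lemma pairing_metric T : pairing T g = \tr (gi *m T).
Proof. by rewrite /pairing -mulmxA mulVmx // mulmx1. Qed.

Lemma trace_ge0 T : T^T = T -> psd T -> 0 <= \tr (gi *m T).
Proof.
move=> Ts Tp; rewrite -pairing_metric; apply: psd_trace; last exact: posdef_psd.
  exact: raised_sym.
exact: raised_psd.
Qed.

(** The rank-one term is [T] at the vector dual to [omega], bounded below by the hypothesis on [T].
    For the other, [K + C g] is positive semidefinite with [C = entry_sum K * entry_sum gi], so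
    pairing it with [T] gives [<T, K> >= - C tr T]. *)
Lemma pairing_lower_bound T K omega (c alpha beta : R) : T^T = T -> psd T ->
  (forall v, c * \tr (gi *m T) * quadform g v <= quadform T v) ->
  0 <= alpha -> 0 <= beta ->
  \tr (gi *m T) * (alpha * (c * quadform gi omega) - beta * (entry_sum K * entry_sum gi))
    <= pairing T (alpha *: (omega^T *m omega) + beta *: K).
Proof.
move=> Ts Tp Tc a0 b0; rewrite /pairing mulmxDr mxtraceD -!scalemxAr !mxtraceZ.
rewrite mulrBr.
have h1 : c * \tr (gi *m T) * quadform gi omega <= \tr (gi *m T *m gi *m (omega^T *m omega)).
  by rewrite [X in _ <= X]mxtrace_mulC trace_rank1 raised_quadform quadform_invmx.
set C := entry_sum K * entry_sum gi.
have Kp : psd (K + C *: g).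
  move=> v; rewrite quadformDl quadformZl -lerBlDr sub0r.
  have := quadform_norm_le K v; rewrite ler_norml => /andP[+ _]; apply: le_trans.
  by rewrite lerN2 /C -mulrA ler_wpM2l ?entry_sum_ge0 // sqnorm_le_quadform.
have h2 := psd_trace (raised_sym Ts) (raised_psd Tp) Kp.
rewrite mulmxDr mxtraceD -scalemxAr mxtraceZ -[X in _ * X]/(pairing T g) pairing_metric in h2.
have h3 := ler_wpM2l a0 h1; have h4 := mulr_ge0 b0 h2.
rewrite mulrDr in h4; lra.
Qed.

(** Since [entry_sum gi * g - 1] is positive semidefinite, the ordinary trace of the raised matrix
    [S] is at most a multiple of the metric trace of [T], hence zero; then its nonnegative diagonal
    vanishes. *)
Lemma trace_eq0 T : T^T = T -> psd T -> \tr (gi *m T) = 0 -> T = 0.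
Proof.
move=> Ts Tp T0; set S := gi *m T *m gi.
have Ss : S^T = S := raised_sym Ts; have Sp : psd S := raised_psd Tp.
have Qp : psd (entry_sum gi *: g + (-1) *: 1%:M).
  by move=> v; rewrite quadformDl !quadformZl quadform1 mulN1r subr_ge0 sqnorm_le_quadform.
have := psd_trace Ss Sp Qp.
rewrite mulmxDr -!scalemxAr mulmx1 mxtraceD !mxtraceZ -[X in _ * X + _]/(pairing T g).
rewrite pairing_metric T0 mulr0 add0r mulN1r oppr_ge0 => trS.
have S0 : S = 0.
  apply: psd_diag0 => // a; apply/eqP; move: (trS); rewrite le_eqVlt ltNge sumr_ge0 ?orbF.
    rewrite psumr_eq0; last by move=> b _; exact: psd_diag_ge0.
    by move=> /allP /(_ a (mem_index_enum _)).
  by move=> b _; exact: psd_diag_ge0.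
have -> : T = g *m S *m g by rewrite /S !mulmxA mulmxV // mul1mx -mulmxA mulVmx // mulmx1.
by rewrite S0 mulmx0 mul0mx.
Qed.

End Metric.

Lemma invmx_congr g J : g \in unitmx -> J \in unitmx ->
  invmx (J *m g *m J^T) = invmx J^T *m invmx g *m invmx J.
Proof.
move=> gu Ju; have JTu : J^T \in unitmx by rewrite unitmx_tr.
have Eu : J *m g *m J^T \in unitmx by rewrite !unitmx_mul Ju gu.
rewrite -[RHS](mulmxK Eu) !mulmxA mulmxKV // mulmxKV // mulVmx // mul1mx.
by [].
Qed.

Lemma trace_congr g J T : g \in unitmx -> J \in unitmx ->
  \tr (invmx (J *m g *m J^T) *m (J *m T *m J^T)) = \tr (invmx g *m T).
Proof.
move=> gu Ju; have JTu : J^T \in unitmx by rewrite unitmx_tr.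
rewrite invmx_congr // !mulmxA mulmxKV // -!mulmxA mxtrace_mulC -!mulmxA mulmxV // mulmx1.
by [].
Qed.

Lemma pairing_congr g J T H : g \in unitmx -> J \in unitmx ->
  pairing (J *m g *m J^T) (J *m T *m J^T) (J *m H *m J^T) = pairing g T H.
Proof.
move=> gu Ju; have JTu : J^T \in unitmx by rewrite unitmx_tr.
rewrite /pairing invmx_congr // !mulmxA mulmxKV // mulmxK // mulmxKV //.
by rewrite mxtrace_mulC !mulmxA mulmxV // mul1mx.
Qed.

End SymmetricForms.

(** * The Hessian in coordinates and its transformation law *)

Section BilinearForms.
Context {R : comNzRingType} {n : nat}.
Implicit Types (u w : 'rV[R]_n) (A : 'M[R]_n).

(** An explicit double sum can be differentiated term by term; [bilE] leads back to matrix
    products. *)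
Definition bil u A w : R := \sum_i \sum_j u 0 i * A i j * w 0 j.

Lemma bilE u A w : bil u A w = (u *m A *m w^T) 0 0.
Proof.
rewrite /bil mxE exchange_big /=; apply: eq_bigr => j _.
by rewrite !mxE mulr_suml.
Qed.

Lemma bil_row (A J : 'M[R]_n) a b : (J *m A *m J^T) a b = bil (row a J) A (row b J).
Proof.
rewrite mxE /bil exchange_big /=; apply: eq_bigr => j _.
by rewrite !mxE mulr_suml; apply: eq_bigr => i _; rewrite !mxE.
Qed.

Lemma bilC u A w : A^T = A -> bil u A w = bil w A u.
Proof.
move=> As; rewrite /bil exchange_big /=; apply: eq_bigr => j _; apply: eq_bigr => i _.
have -> : A i j = A j i by rewrite -[in LHS]As mxE.
by rewrite mulrC mulrA mulrAC.
Qed.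

End BilinearForms.

Section HessianInCoordinates.
Context {R : realType} {n : nat}.
Implicit Types (f : 'rV[R]_n -> R) (x y : 'rV[R]_n) (G : 'rV[R]_n -> 'M[R]_n).

Definition gradient f x : 'rV[R]_n := \row_c pderiv c f x.

(* The Christoffel symbols of the first kind [Gamma_{d,ab}], as a row in [d]. *)
Definition lowered G a b x : 'rV[R]_n := \row_d (2^-1 *
  (pderiv a (fun y => G y b d) x + pderiv b (fun y => G y a d) x
   - pderiv d (fun y => G y a b) x)).

(** With symbols of the first kind, the inverse metric occurs only undifferentiated: the
    transformation law comes from differentiating [G' = J G J^T] alone. *)
Definition hessian G f x : 'M[R]_n := \matrix_(a, b)
  (pderiv a (pderiv b f) x - bil (lowered G a b x) (invmx (G x)) (gradient f x)).

Lemma pderiv_sum (I : Type) (r : seq I) (F : I -> 'rV[R]_n -> R) a x :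
  (forall i, derivable (F i) x (delta_mx 0 a)) ->
  derivable (fun y => \sum_(i <- r) F i y) x (delta_mx 0 a) /\
  pderiv a (fun y => \sum_(i <- r) F i y) x = \sum_(i <- r) pderiv a (F i) x.
Proof.
move=> dF; elim: r => [|i r [dr IH]].
  have -> : (fun y => \sum_(i <- [::]) F i y) = (fun=> 0) by apply/funext => y; rewrite big_nil.
  by rewrite big_nil; split; [exact: derivable_cst|exact: pderiv_cst].
have -> : (fun y => \sum_(j <- i :: r) F j y) = (fun y => F i y + \sum_(j <- r) F j y).
  by apply/funext => y; rewrite big_cons.
split; first exact: (derivableD (dF i) dr).
by rewrite big_cons (pderivD (dF i) dr); congr (_ + _).
Qed.

Lemma pderiv_bil (u w : 'rV[R]_n -> 'rV[R]_n) (A : 'rV[R]_n -> 'M[R]_n) a x :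
  (forall i, derivable (fun y => u y 0 i) x (delta_mx 0 a)) ->
  (forall i, derivable (fun y => w y 0 i) x (delta_mx 0 a)) ->
  (forall i j, derivable (fun y => A y i j) x (delta_mx 0 a)) ->
  pderiv a (fun y => bil (u y) (A y) (w y)) x =
    bil (\row_i pderiv a (fun y => u y 0 i) x) (A x) (w x)
    + bil (u x) (\matrix_(i, j) pderiv a (fun y => A y i j) x) (w x)
    + bil (u x) (A x) (\row_i pderiv a (fun y => w y 0 i) x).
Proof.
move=> du dw dA.
have duA i j : derivable (fun y => u y 0 i * A y i j) x (delta_mx 0 a) by exact: derivableM.
have dt i j : derivable (fun y => u y 0 i * A y i j * w y 0 j) x (delta_mx 0 a).
  by have := derivableM (duA i j) (dw j).
rewrite /bil (pderiv_sum _ (fun i => (pderiv_sum _ (dt i)).1)).2 -!big_split /=.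
apply: eq_bigr => i _; rewrite (pderiv_sum _ (dt i)).2 -!big_split /=.
apply: eq_bigr => j _; rewrite (pderivM (duA i j) (dw j)) (pderivM (du i) (dA i j)) !mxE.
by rewrite mulrDl.
Qed.

Section ChangeOfCoordinates.
Variables (V W : set 'rV[R]_n) (psi : 'rV[R]_n -> 'rV[R]_n).
Variables (f : 'rV[R]_n -> R) (G G' : 'rV[R]_n -> 'M[R]_n) (x : 'rV[R]_n).
Hypotheses (oV : open V) (oW : open W) (Vx : V x) (psiVW : forall y, V y -> W (psi y)).
Hypothesis psi2 : forall c, Ck_on 2 V (fun y => psi y 0 c).
Hypothesis f2 : Ck_on 2 W f.
Hypothesis G1 : forall a b, Ck_on 1 W (fun y => G y a b).
Variables (J : 'rV[R]_n -> 'M[R]_n) (K : 'I_n -> 'I_n -> 'rV[R]_n).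
Hypothesis JE : forall y a c, J y a c = pderiv a (fun z => psi z 0 c) y.
Hypothesis KE : forall a b c, K a b 0 c = pderiv a (pderiv b (fun y => psi y 0 c)) x.
Hypothesis G'E : forall y, V y -> G' y = J y *m G (psi y) *m (J y)^T.
Hypothesis Gsym : (G (psi x))^T = G (psi x).
Hypothesis Gunit : G (psi x) \in unitmx.
Hypothesis Junit : J x \in unitmx.

Let psi_diff y : V y -> differentiable psi y.
Proof.
move=> Vy; apply: differentiable_rV => c.
exact: C1_differentiable oV Vy (Ck_onS (psi2 c)).
Qed.

Let chain h a y : V y -> Ck_on 1 W h ->
  derivable (h \o psi) y (delta_mx 0 a) /\
  pderiv a (h \o psi) y = \sum_c J y a c * pderiv c h (psi y).
Proof.
move=> Vy h1; have dh := C1_differentiable oW (psiVW Vy) h1.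
split; first by apply: diff_derivable; exact: differentiable_comp (psi_diff Vy) dh.
rewrite pderiv_chain //; last exact: psi_diff.
by apply: eq_bigr => c _; rewrite jacobian_entry ?JE //; exact: psi_diff.
Qed.

Let KC a b : K a b = K b a.
Proof. by apply/rowP => c; rewrite !KE; exact: (@pderivC R n V (fun y => psi y 0 c) x a b oV Vx (psi2 c)). Qed.

Let dJ a b c : derivable (fun y => J y b c) x (delta_mx 0 a).
Proof.
have -> : (fun y => J y b c) = pderiv b (fun y => psi y 0 c).
  by apply/funext => y; rewrite JE.
exact: Ck_on_derivable (Ck_on_pderiv b (psi2 c)) Vx.
Qed.

Let pderivJ a b c : pderiv a (fun y => J y b c) x = K a b 0 c.
Proof. by rewrite KE; congr (pderiv a _ x); apply/funext => y; rewrite JE. Qed.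

Let gradient_comp : gradient (f \o psi) x = gradient f (psi x) *m (J x)^T.
Proof.
apply/rowP => a; rewrite !mxE (chain a Vx (Ck_onS f2)).2.
by apply: eq_bigr => c _; rewrite !mxE mulrC.
Qed.

(** The sum with [K] is the non-tensorial part, to be cancelled by the Christoffel term. *)
Let second a b : pderiv a (pderiv b (f \o psi)) x =
  \sum_c K a b 0 c * pderiv c f (psi x) +
  bil (row a (J x)) (\matrix_(d, c) pderiv d (pderiv c f) (psi x)) (row b (J x)).
Proof.
have E y : V y -> pderiv b (f \o psi) y = \sum_c J y b c * pderiv c f (psi y).
  by move=> Vy; exact: (chain b Vy (Ck_onS f2)).2.
rewrite (pderiv_eq_on a oV Vx E).
have c2 c := chain a Vx (Ck_on_pderiv c f2).
have dt c : derivable (fun y => J y b c * (pderiv c f \o psi) y) x (delta_mx 0 a).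
  exact: (derivableM (@dJ a b c) (c2 c).1).
rewrite (pderiv_sum _ dt).2 /bil exchange_big -big_split /=; apply: eq_bigr => c _.
rewrite (pderivM (@dJ a b c) (c2 c).1) pderivJ (c2 c).2 /=; congr (_ + _).
rewrite mulr_sumr; apply: eq_bigr => d _; rewrite !mxE.
by rewrite mulrC.
Qed.

Let dG a : 'M[R]_n := \matrix_(i, j) pderiv a (fun y => G y i j) (psi x).

Let pderivG' a b d : pderiv a (fun y => G' y b d) x =
  bil (K a b) (G (psi x)) (row d (J x))
  + \sum_e J x a e * bil (row b (J x)) (dG e) (row d (J x))
  + bil (row b (J x)) (G (psi x)) (K a d).
Proof.
have E y : V y -> G' y b d = bil (row b (J y)) (G (psi y)) (row d (J y)).
  by move=> Vy; rewrite (G'E Vy) bil_row.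
rewrite (pderiv_eq_on a oV Vx E).
have drow b' i : derivable (fun y => row b' (J y) 0 i) x (delta_mx 0 a).
  have -> : (fun y => row b' (J y) 0 i) = (fun y => J y b' i) by apply/funext => y; rewrite mxE.
  exact: dJ.
have Erow b' : (\row_i pderiv a (fun y => row b' (J y) 0 i) x) = K a b'.
  apply/rowP => i; rewrite mxE -pderivJ; congr (pderiv a _ x).
  by apply/funext => y; rewrite mxE.
rewrite (pderiv_bil (drow b) (drow d) (fun i j => (chain a Vx (G1 i j)).1)) !Erow.
congr (_ + _ + _).
under [RHS]eq_bigr do rewrite /bil mulr_sumr.
rewrite exchange_big /=; apply: eq_bigr => i _.
under [RHS]eq_bigr do rewrite mulr_sumr.
rewrite exchange_big /=; apply: eq_bigr => j _.
rewrite !mxE (chain a Vx (G1 i j)).2 mulr_sumr mulr_suml.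
by apply: eq_bigr => e _; rewrite !mxE; ring.
Qed.

Let P a b : 'rV[R]_n :=
  \sum_i \sum_j (J x a i * J x b j) *: lowered G i j (psi x).

(** Differentiating [J G J^T] in the three terms of the symbol yields six terms with second
    derivatives of [psi]. By symmetry of [K] and [G], four of them cancel and two agree, which
    absorbs the factor one half. *)
Let loweredE a b : lowered G' a b x = (P a b + K a b *m G (psi x)) *m (J x)^T.
Proof.
apply/rowP => d; rewrite mulmxDl [in RHS]mxE [in LHS]mxE !pderivG'.
have -> : (K a b *m G (psi x) *m (J x)^T) 0 d = bil (K a b) (G (psi x)) (row d (J x)).
  rewrite bilE !mxE; apply: eq_bigr => j _; rewrite !mxE.
  by [].
rewrite (bilC (row b (J x)) (K a d) Gsym) (bilC (row a (J x)) (K b d) Gsym).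
rewrite (bilC (row a (J x)) (K d b) Gsym) (KC b a) (KC d a) (KC d b).
set t1 := bil (K a b) _ _; set t2 := bil (K a d) _ _; set t3 := bil (K b d) _ _.
have -> : (P a b *m (J x)^T) 0 d = 2^-1 *
   (\sum_e J x a e * bil (row b (J x)) (dG e) (row d (J x))
   + \sum_e J x b e * bil (row a (J x)) (dG e) (row d (J x))
   - \sum_e J x d e * bil (row a (J x)) (dG e) (row b (J x))).
  (* The three sums are reindexed to share the factor [J_ai J_bj J_dk], so that the symbol of [G]
     appears under a single triple sum. *)
  have E1 : \sum_e J x a e * bil (row b (J x)) (dG e) (row d (J x)) =
      \sum_i \sum_j \sum_k J x a i * J x b j * J x d k * dG i j k.
    apply: eq_bigr => i _; rewrite /bil mulr_sumr; apply: eq_bigr => j _.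
    by rewrite mulr_sumr; apply: eq_bigr => k _; rewrite [row b _ _ _]mxE [row d _ _ _]mxE; ring.
  have E2 : \sum_e J x b e * bil (row a (J x)) (dG e) (row d (J x)) =
      \sum_i \sum_j \sum_k J x a i * J x b j * J x d k * dG j i k.
    rewrite exchange_big /=; apply: eq_bigr => j _; rewrite /bil mulr_sumr; apply: eq_bigr => i _.
    by rewrite mulr_sumr; apply: eq_bigr => k _; rewrite [row a _ _ _]mxE [row d _ _ _]mxE; ring.
  have E3 : \sum_e J x d e * bil (row a (J x)) (dG e) (row b (J x)) =
      \sum_i \sum_j \sum_k J x a i * J x b j * J x d k * dG k i j.
    under eq_bigr do rewrite /bil mulr_sumr.
    rewrite exchange_big /=; apply: eq_bigr => i _.
    under eq_bigr do rewrite mulr_sumr.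
    rewrite exchange_big /=; apply: eq_bigr => j _; apply: eq_bigr => k _.
    by rewrite [row a _ _ _]mxE [row b _ _ _]mxE; ring.
  rewrite E1 E2 E3 -sumrN -!big_split /= mulr_sumr.
  rewrite /P mulmx_suml summxE; apply: eq_bigr => i _.
  rewrite mulmx_suml summxE -sumrN -!big_split /= mulr_sumr; apply: eq_bigr => j _.
  rewrite -sumrN -!big_split /= mulr_sumr -scalemxAl mxE mxE mulr_sumr.
  apply: eq_bigr => k _; rewrite /dG !mxE; ring.
by field.
Qed.

(** In the Christoffel term the inverse of [J G J^T] removes the Jacobians and turns [K G] into [K],
    giving exactly the anomalous term of [second]. *)
Lemma hessian_change : hessian G' (f \o psi) x = J x *m hessian G f (psi x) *m (J x)^T.
Proof.
have JTu : (J x)^T \in unitmx by rewrite unitmx_tr.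
apply/matrixP => a b; rewrite bil_row [in LHS]mxE second.
have -> : bil (lowered G' a b x) (invmx (G' x)) (gradient (f \o psi) x) =
    bil (P a b) (invmx (G (psi x))) (gradient f (psi x)) + \sum_c K a b 0 c * pderiv c f (psi x).
  rewrite !bilE loweredE (G'E Vx) invmx_congr // gradient_comp trmx_mul trmxK.
  rewrite !mulmxA mulmxK // mulmxKV // !mulmxDl mulmxK // mxE; congr (_ + _).
  by rewrite mxE; apply: eq_bigr => c _; rewrite !mxE.
have -> : bil (row a (J x)) (hessian G f (psi x)) (row b (J x)) =
    bil (row a (J x)) (\matrix_(d, c) pderiv d (pderiv c f) (psi x)) (row b (J x)) -
    bil (P a b) (invmx (G (psi x))) (gradient f (psi x)).
  rewrite [X in _ = _ - X]bilE /P !mulmx_suml summxE /bil -sumrB; apply: eq_bigr => i _.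
  rewrite !mulmx_suml summxE -sumrB; apply: eq_bigr => j _.
  rewrite -!scalemxAl [X in _ = _ - X]mxE -bilE !mxE; ring.
ring.
Qed.

End ChangeOfCoordinates.
End HessianInCoordinates.

Section HessianCalculus.
Context {R : realType} {n : nat}.
Implicit Types (f s : 'rV[R]_n -> R) (x : 'rV[R]_n) (G : 'rV[R]_n -> 'M[R]_n).

Lemma hessian_eq_on (V : set 'rV[R]_n) G f1 f2 x : open V -> V x ->
  (forall y, V y -> f1 y = f2 y) -> hessian G f1 x = hessian G f2 x.
Proof.
move=> oV Vx f12.
have grad12 : gradient f1 x = gradient f2 x.
  by apply/rowP => c; rewrite !mxE; exact: (pderiv_eq_on c oV Vx f12).
have hess12 a b : pderiv a (pderiv b f1) x = pderiv a (pderiv b f2) x.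
  by apply: (pderiv_eq_on a oV Vx) => y Vy; exact: (pderiv_eq_on b oV Vy f12).
by apply/matrixP => a b; rewrite [LHS]mxE [RHS]mxE grad12 hess12.
Qed.

Lemma hessian_cst G (c : R) x : hessian G (fun=> c) x = 0.
Proof.
apply/matrixP => a b; rewrite !mxE.
have E d : pderiv d (fun=> c) = (fun=> 0 : R) by apply/funext => y; exact: pderiv_cst.
rewrite E pderiv_cst sub0r /bil big1 ?oppr0 // => i _; rewrite big1 // => j _.
by rewrite [gradient _ _ _ _]mxE E mulr0.
Qed.

Lemma hessian_comp (V : set 'rV[R]_n) G (F F1 F2 : R -> R) s x : open V -> V x ->
  Ck_on 2 V s -> (forall t : R, is_derive t 1 F (F1 t)) ->
  (forall t : R, is_derive t 1 F1 (F2 t)) ->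
  hessian G (F \o s) x =
    F2 (s x) *: ((gradient s x)^T *m gradient s x) + F1 (s x) *: hessian G s x.
Proof.
move=> oV Vx s2 dF dF1.
have D a y : V y -> pderiv a (F \o s) y = F1 (s y) * pderiv a s y.
  by move=> Vy; have [_ ->] := is_pderiv_comp a (C1_differentiable oV Vy (Ck_onS s2)) (dF (s y)).
have D1 a := is_pderiv_comp a (C1_differentiable oV Vx (Ck_onS s2)) (dF1 (s x)).
apply/matrixP => a b.
have -> : hessian G (F \o s) x a b = pderiv a (pderiv b (F \o s)) x -
  bil (lowered G a b x) (invmx (G x)) (gradient (F \o s) x) by rewrite mxE.
rewrite (pderiv_eq_on a oV Vx (D b)).
rewrite (pderivM (D1 a).1 (Ck_on_derivable (Ck_on_pderiv b s2) Vx)) (D1 a).2 /=.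
have -> : gradient (F \o s) x = F1 (s x) *: gradient s x.
  by apply/rowP => c; rewrite !mxE (D c x Vx).
have -> : bil (lowered G a b x) (invmx (G x)) (F1 (s x) *: gradient s x) =
    F1 (s x) * bil (lowered G a b x) (invmx (G x)) (gradient s x).
  by rewrite !bilE linearZ /= -scalemxAr mxE.
have -> : (F2 (s x) *: ((gradient s x)^T *m gradient s x) + F1 (s x) *: hessian G s x) a b =
    F2 (s x) * (pderiv a s x * pderiv b s x) + F1 (s x) * (pderiv a (pderiv b s) x -
      bil (lowered G a b x) (invmx (G x)) (gradient s x)).
  by rewrite mxE [(_ *: (_ *m _)) a b]mxE [(_ *: hessian _ _ _) a b]mxE [hessian _ _ _ a b]mxE
    [(_ *m _) a b]mxE big_ord1 !mxE.
ring.
Qed.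

End HessianCalculus.

(** * Tensors and Hessians across the charts of the manifold *)

Section Charts.
Context {R : realType} {n : nat} {M : manifold R n}.
Implicit Types (i j : chart_index M) (p : M) (x : 'rV[R]_n).

Lemma paramK i p : dom i p -> param i (coord i p) = p.
Proof. exact: cmapK. Qed.

Lemma img_coord i p : dom i p -> img i (coord i p).
Proof. by move=> ip; exists p. Qed.

Lemma dom_param i x : img i x -> dom i (param i x).
Proof. by case=> p ip <-; rewrite [param _ _]paramK. Qed.

Lemma coordK i x : img i x -> coord i (param i x) = x.
Proof. by case=> p ip <-; rewrite [param _ _]paramK. Qed.

Lemma open_dom i : open (dom i).
Proof. exact: cdom_open. Qed.

Lemma open_img i : open (img i).
Proof. exact: cimg_open. Qed.

Lemma dom_chart_at p : dom (chart_at p) p.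
Proof. exact: mem_chart_at. Qed.

Lemma coord_continuous_at i p : dom i p -> {for p, continuous (coord i)}.
Proof. exact: cmap_continuous. Qed.

Lemma param_continuous_at i x : img i x -> {for x, continuous (param i)}.
Proof. exact: cinv_continuous. Qed.

Lemma open_img_preimage i (A : set M) : open A -> open (img i `&` param i @^-1` A).
Proof.
move=> oA; rewrite openE => x [ix Ax].
apply: filterI; first by apply: open_nbhs_nbhs; split=> //; exact: open_img.
by apply: (param_continuous_at ix); apply: open_nbhs_nbhs; split.
Qed.

Lemma open_dom_preimage i (A : set 'rV[R]_n) : open A -> open (dom i `&` coord i @^-1` A).
Proof.
move=> oA; rewrite openE => p [ip Ap].
apply: filterI; first by apply: open_nbhs_nbhs; split=> //; exact: open_dom.
by apply: (coord_continuous_at ip); apply: open_nbhs_nbhs; split.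
Qed.

Definition overlap i j : set 'rV[R]_n := img i `&` param i @^-1` (dom j).

Lemma open_overlap i j : open (overlap i j).
Proof. exact/open_img_preimage/open_dom. Qed.

Lemma overlap_coord i j p : dom i p -> dom j p -> overlap i j (coord i p).
Proof. by move=> ip jp; split; [exact: img_coord|rewrite /= paramK]. Qed.

Lemma overlapP i j x : overlap i j x -> exists p, [/\ dom i p, dom j p & x = coord i p].
Proof.
by move=> [ix jx]; exists (param i x); split=> //; [exact: dom_param|rewrite coordK].
Qed.

Lemma transition_Ck k i j (c : 'I_n) :
  Ck_on k (overlap i j) (fun x => coord j (param i x) 0 c).
Proof.
apply: Ck_on_sub (smooth_transition i j c k) => x /overlapP[p [ip jp ->]].
by exists p.
Qed.

End Charts.

Section TensorsInCharts.
Context {R : realType} {n : nat} {M : manifold R n}.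
Variable g : metric M.
Implicit Types (T : sym2tensor M) (phi : M -> R) (i j : chart_index M) (p : M).

Lemma metric_sym i p : dom i p -> (g i p)^T = g i p.
Proof. exact: components_sym. Qed.

Lemma metric_posdef_at i p : dom i p -> posdef (g i p).
Proof. by move=> ip v; exact: metric_posdef. Qed.

Lemma metric_unit i p : dom i p -> g i p \in unitmx.
Proof. by move=> ip; exact/posdef_unitmx/metric_posdef_at. Qed.

Definition jac i j p : 'M[R]_n := 'J (coord j \o param i) (coord i p).

Lemma tensor_change T i j p : dom i p -> dom j p ->
  T i p = jac i j p *m T j p *m (jac i j p)^T.
Proof. by move=> ip jp; rewrite [LHS](components_change T ip jp). Qed.

(** The transformation law writes the invertible matrix [g i p] as a product with this Jacobian as a
    factor. *)
Lemma jac_unit i j p : dom i p -> dom j p -> jac i j p \in unitmx.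
Proof.
move=> ip jp; have := metric_unit ip.
by rewrite (tensor_change g ip jp) !unitmx_mul => /andP[/andP[]].
Qed.

Lemma jac_entry i j x a c : overlap i j x ->
  'J (coord j \o param i) x a c = pderiv a (fun y => coord j (param i y) 0 c) x.
Proof.
move=> ox; apply: jacobian_entry; apply: differentiable_rV => d.
exact: (C1_differentiable (@open_overlap _ _ _ i j) ox (transition_Ck 1 i j d)).
Qed.

Definition metric_in i : 'rV[R]_n -> 'M[R]_n := fun y => g i (param i y).

Lemma hessE phi i p : dom i p ->
  hess g phi i p = hessian (metric_in i) (phi \o param i) (coord i p).
Proof.
move=> ip; apply/matrixP => a b; rewrite !mxE; congr (_ - _).
rewrite /bil exchange_big /=; apply: eq_bigr => c _.
rewrite /christoffel mulr_sumr mulr_suml.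
apply: eq_bigr => d _; rewrite !mxE /metric_in paramK //.
have -> : invmx (g i p) c d = invmx (g i p) d c.
  by rewrite -[in LHS](invmx_sym (metric_sym ip)) mxE.
by ring.
Qed.

(** On the overlap, [phi] read in chart [i] is [phi] read in chart [j] after the transition map, so
    [hessian_change] applies with that map as [psi]. *)
Lemma hess_change phi i j p : smooth_fun phi -> dom i p -> dom j p ->
  hess g phi i p = jac i j p *m hess g phi j p *m (jac i j p)^T.
Proof.
move=> sphi ip jp; rewrite !hessE //.
have oV : open (overlap i j) := @open_overlap _ _ _ i j; have Vx := overlap_coord ip jp.
have psix : (coord j \o param i) (coord i p) = coord j p by rewrite /= paramK.
have -> : hessian (metric_in i) (phi \o param i) (coord i p) =
    hessian (metric_in i) ((phi \o param j) \o (coord j \o param i)) (coord i p).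
  apply: (hessian_eq_on _ oV Vx) => y /overlapP[q [iq jq ->]] /=.
  by rewrite !paramK.
have H := @hessian_change R n (overlap i j) (img j) (coord j \o param i) (phi \o param j)
  (metric_in j) (metric_in i) (coord i p) oV (@open_img _ _ _ j) Vx _ (transition_Ck 2 i j)
  (sphi j 2) (fun a b => metric_smooth g j a b 1)
  (fun y => \matrix_(a, c) pderiv a (fun z => (coord j \o param i) z 0 c) y)
  (fun a b => \row_c pderiv a (pderiv b (fun y => (coord j \o param i) y 0 c)) (coord i p)).
have JE : \matrix_(a, c) pderiv a (fun z => (coord j \o param i) z 0 c) (coord i p) = jac i j p.
  by apply/matrixP => a c; rewrite mxE /jac jac_entry.
rewrite H ?psix ?JE //.
- by move=> y [_ jy]; exact: img_coord.
- by move=> y a c; rewrite mxE.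
- by move=> a b c; rewrite mxE.
- move=> y oy; have [q [iq jq yE]] := overlapP oy.
  have -> : \matrix_(a, c) pderiv a (fun z => (coord j \o param i) z 0 c) y = jac i j q.
    by apply/matrixP => a c; rewrite mxE /jac -yE jac_entry.
  by rewrite /metric_in yE /= !paramK // (tensor_change g iq jq).
- by rewrite /metric_in paramK // metric_sym.
- by rewrite /metric_in paramK // metric_unit.
- exact: jac_unit.
Qed.

Lemma tensor_inner_pairing T H p :
  tensor_inner g T H p =
  pairing (g (chart_at p) p) (T (chart_at p) p) (H (chart_at p) p).
Proof.
have ip := dom_chart_at p; rewrite /tensor_inner; move: (chart_at p) ip => i ip.
have Ss := raised_sym (metric_sym ip) (components_sym T ip).
rewrite /pairing -mxtrace_tr trmx_mul Ss mxtrace_mulC.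
have gis c a : invmx (g i p) a c = invmx (g i p) c a.
  by rewrite -[in LHS](invmx_sym (metric_sym ip)) mxE.
rewrite /mxtrace exchange_big [RHS](eq_bigr (fun c => \sum_d \sum_b \sum_a
    invmx (g i p) a c * invmx (g i p) b d * T i p a b * H i p c d)).
  under eq_bigr do rewrite exchange_big /=.
  rewrite exchange_big /=; apply: eq_bigr => c _.
  under eq_bigr do rewrite exchange_big /=.
  by rewrite exchange_big /=.
move=> c _; rewrite mxE; apply: eq_bigr => d _.
rewrite !mxE mulr_suml; apply: eq_bigr => b _.
rewrite !mxE mulr_suml mulr_suml; apply: eq_bigr => a _.
by rewrite (gis c a); ring.
Qed.

Lemma tensor_inner_hess T phi i p : smooth_fun phi -> dom i p ->
  tensor_inner g T (hess g phi) p = pairing (g i p) (T i p) (hess g phi i p).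
Proof.
move=> sphi ip; rewrite tensor_inner_pairing.
have kp := dom_chart_at p; move: (chart_at p) kp => k kp.
rewrite (tensor_change g kp ip) (tensor_change T kp ip) (hess_change sphi kp ip).
by rewrite pairing_congr // ?metric_unit // jac_unit.
Qed.

Lemma tensor_trace_in T i p : dom i p ->
  tensor_trace g T p = \tr (invmx (g i p) *m T i p).
Proof.
move=> ip; have kp := dom_chart_at p; rewrite /tensor_trace; move: (chart_at p) kp => k kp.
rewrite (tensor_change g kp ip) (tensor_change T kp ip).
by rewrite trace_congr // ?metric_unit // jac_unit.
Qed.

Lemma tensor_le_in (c : R) (S T : sym2tensor M) i p : dom i p -> tensor_le c S T p ->
  forall v, c * quadform (S i p) v <= quadform (T i p) v.
Proof.
move=> ip cST v; have kp := dom_chart_at p.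
by rewrite (tensor_change S ip kp) (tensor_change T ip kp) !quadform_congr; exact: cST.
Qed.

Lemma tensor_ge0_in T i p : dom i p -> tensor_ge0 T p -> psd (T i p).
Proof.
move=> ip T0 v; have kp := dom_chart_at p.
by rewrite (tensor_change T ip kp) quadform_congr; exact: T0.
Qed.

Lemma tensor_eq0_in T i p : dom i p -> tensor_eq0 T p <-> T i p = 0.
Proof.
move=> ip; have kp := dom_chart_at p; rewrite /tensor_eq0; split=> T0.
  by rewrite (tensor_change T ip kp) T0 mulmx0 mul0mx.
by rewrite (tensor_change T kp ip) T0 mulmx0 mul0mx.
Qed.

Lemma hess_local0 phi i p (A : set M) : open A -> A p -> dom i p ->
  (forall q, A q -> phi q = 0) -> hess g phi i p = 0.
Proof.
move=> oA Ap ip phi0; rewrite hessE //.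
rewrite (@hessian_eq_on _ _ (img i `&` param i @^-1` A) _ _ (fun=> 0)) ?hessian_cst //.
- exact: open_img_preimage.
- by split; [exact: img_coord|rewrite /= paramK].
- by move=> y [_ Ay]; exact: phi0.
Qed.

End TensorsInCharts.

(** * Continuity of the inverse matrix and bounds on compact sets *)

Section MatrixLimits.
Context {R : realType} {T : Type} {F : set_system T} {FF : Filter F}.

Lemma cvg_prodR (I : Type) (r : seq I) (f : I -> T -> R) (l : I -> R) :
  (forall i, f i t @[t --> F] --> l i) ->
  \prod_(i <- r) f i t @[t --> F] --> \prod_(i <- r) l i.
Proof. by move=> fl; apply: cvg_big => //; exact: mul_continuous. Qed.

Lemma cvg_det m (A : T -> 'M[R]_m) (B : 'M[R]_m) :
  (forall i j, A t i j @[t --> F] --> B i j) -> \det (A t) @[t --> F] --> \det B.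
Proof.
move=> AB; rewrite /determinant; apply: cvg_sumR => s.
by apply: cvgMr; apply: cvg_prodR => i.
Qed.

(** By Cramer's formula, the entries are quotients of polynomials. [invmx] follows this formula only
    on invertible matrices, hence the condition near the limit. *)
Lemma cvg_invmx m (A : T -> 'M[R]_m) (B : 'M[R]_m) i j : B \in unitmx ->
  (\forall t \near F, A t \in unitmx) ->
  (forall i j, A t i j @[t --> F] --> B i j) ->
  invmx (A t) i j @[t --> F] --> invmx B i j.
Proof.
move=> Bu Au AB.
have E C : C \in unitmx -> invmx C i j = (\det C)^-1 * \adj C i j :> R.
  by move=> Cu; rewrite /invmx Cu mxE.
rewrite (E B Bu).
have H : (\det (A t))^-1 * \adj (A t) i j @[t --> F] --> (\det B)^-1 * \adj B i j.
  apply: cvgM.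
    by apply: cvgV; [move: Bu; rewrite unitmxE unitfE|exact: cvg_det].
  rewrite mxE; under eq_cvg do rewrite mxE.
  apply: cvgMr; apply: cvg_det => k l; rewrite !mxE.
  by under eq_cvg do rewrite !mxE; exact: AB.
apply: cvg_trans H; apply: near_eq_cvg.
by apply: filterS Au => t At; rewrite E.
Qed.

End MatrixLimits.

Section CompactBounds.
Context {R : realType}.

Lemma compact_bounded_fun (X : topologicalType) (K : set X) (f : X -> R) : compact K ->
  (forall x, K x -> {for x, continuous f}) -> exists B, forall x, K x -> `|f x| <= B.
Proof.
move=> cK fc; have [->|K0] := eqVneq K set0; first by exists 0.
have [|c _ Hc] := @compact_EVT_max X R (fun x => `|f x|) K ((set0P K).1 K0) cK.
  apply: continuous_in_subspaceT => x; rewrite inE => Kx.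
  exact: continuous_comp (fc x Kx) (@norm_continuous _ _ _).
by exists `|f c| => x Kx; apply: Hc; rewrite inE.
Qed.

Lemma compact_bounded_entries (X : topologicalType) n (K : set X) (A : X -> 'M[R]_n) : compact K ->
  (forall x i j, K x -> {for x, continuous (fun y => A y i j)}) ->
  exists2 B : R, 0 < B & forall x, K x -> entry_sum (A x) <= B.
Proof.
move=> cK Ac.
have /choice[B HB] : forall k : 'I_n * 'I_n, exists B : R, forall x, K x -> `|A x k.1 k.2| <= B.
  by move=> [i j]; apply: compact_bounded_fun => // x Kx; exact: Ac.
(* The added 1 makes the bound positive, so that it can serve as a divisor. *)
exists (1 + \sum_i \sum_j `|B (i, j)|).
  by rewrite ltr_pwDl //; apply: sumr_ge0 => i _; exact: sumr_ge0.
move=> x Kx; apply: (@le_trans _ _ (\sum_i \sum_j `|B (i, j)|)); last by rewrite lerDr.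
apply: ler_sum => i _; apply: ler_sum => j _.
by apply: le_trans (ler_norm _); exact: HB (i, j) x Kx.
Qed.

Lemma continuous_hessian n (V : set 'rV[R]_n) (G : 'rV[R]_n -> 'M[R]_n) (s : 'rV[R]_n -> R) x a b :
  open V -> V x -> (forall i j, Ck_on 1 V (fun y => G y i j)) ->
  (forall y, V y -> G y \in unitmx) -> Ck_on 2 V s ->
  {for x, continuous (fun y => hessian G s y a b)}.
Proof.
move=> oV Vx G1 Gu s2.
have FF : Filter (nbhs x) by exact: nbhs_filter.
have nV : \forall y \near x, G y \in unitmx.
  have : nbhs x V by exact: open_nbhs_nbhs.
  by apply: filterS => y; exact: Gu.
change (hessian G s y a b @[y --> x] --> hessian G s x a b).
rewrite mxE; under eq_cvg do rewrite mxE.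
apply: cvgB; first exact: (Ck_on_continuous (Ck_on_pderiv a (Ck_on_pderiv b s2)) Vx).
rewrite /bil; apply: cvg_sumR => i; apply: cvg_sumR => j.
apply: cvgM; last first.
  rewrite mxE; under eq_cvg do rewrite mxE.
  exact: (Ck_on_continuous (Ck_on_pderiv j s2) Vx).
apply: cvgM; last first.
  apply: cvg_invmx => //; first exact: Gu.
  by move=> k l; exact: (Ck_on_continuous (G1 k l) Vx).
rewrite mxE; under eq_cvg do rewrite mxE.
have dG c k l : pderiv c (fun z => G z k l) y @[y --> x] --> pderiv c (fun z => G z k l) x.
  exact: (Ck_on_continuous (Ck_on_pderiv c (G1 k l)) Vx).
by apply: cvgMr; apply: cvgB; [apply: cvgD|]; exact: dG.
Qed.

End CompactBounds.

(** * A zero integral with a nonnegative measurable minorant *)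

Section DominatedZeroIntegral.
Context d (X : measurableType d) (R : realType) (mu : {measure set X -> \bar R}).
Local Open Scope ereal_scope.

(** Monotonicity is read off the definition as a supremum over simple functions below, so it covers
    the integrand of the next lemma, which is an arbitrary function. *)
Lemma le_integral_ge0 (f1 f2 : X -> \bar R) : (forall x, 0 <= f1 x) ->
  (forall x, f1 x <= f2 x) -> \int[mu]_x f1 x <= \int[mu]_x f2 x.
Proof.
move=> f10 f12; rewrite !ge0_integralTE //; last by move=> x; exact: le_trans (f12 x).
by apply: le_ereal_sup => _ [h hf <-]; exists h => // x; exact: le_trans (f12 x).
Qed.

(** The negative part of [f] lives on the null set [N] and is dominated there by [+oo], so it
    integrates to zero. Hence the positive part does too, and it dominates [h] off [N]. *)
Lemma integral_eq0_dominated (f h : X -> R) : measurable_fun setT h ->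
  (forall x, (0 <= h x)%R) -> {ae mu, forall x, (h x <= f x)%R} ->
  \int[mu]_x (f x)%:E = 0 -> {ae mu, forall x, h x = 0%R}.
Proof.
move=> mh h0 [N [mN N0 hN]] f0; pose f' x := (f x)%:E.
have hf x : ~ N x -> (h x <= f x)%R by move=> Nx; apply: contrapT => hfx; exact/Nx/hN.
have neg0 : \int[mu]_x f'^\- x = 0.
  apply/eqP; rewrite eq_le integral_ge0 ?andbT //.
  have -> : 0 = \int[mu]_(x in N) cst +oo x by rewrite integral_cst // N0 mule0.
  rewrite [X in _ <= X]integral_mkcond; apply: le_integral_ge0 => // x.
  rewrite patchE; case: ifPn => [_|]; first exact: leey.
  rewrite notin_setE => Nx; change (f'^\- x <= 0); rewrite funenegE /f'.
  rewrite -EFinN -EFin_max lee_fin ge_max lexx andbT.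
  by rewrite oppr_le0 (le_trans (h0 x)) // hf.
have pos0 : \int[mu]_x f'^\+ x = 0.
  by move: f0; rewrite integralE neg0 sube0.
have int0 : \int[mu]_(x in ~` N) `|(EFin \o h) x| = 0.
  apply/eqP; rewrite eq_le integral_ge0 ?andbT // -[leRHS]pos0 integral_mkcond.
  apply: le_integral_ge0 => x; first by apply: erestrict_ge0.
  rewrite patchE; case: ifPn => [|_]; last exact: funepos_ge0.
  rewrite inE => Nx; by rewrite funeposE /f' /= ger0_norm // le_max lee_fin hf.
have mNC : measurable (~` N) by exact: measurableC.
have mh' : measurable_fun (~` N) (EFin \o h) by apply/measurable_EFinP; exact: measurable_funTS.
have := (ae_eq_integral_abs mu mNC mh').1 int0.
have NC : {ae mu, forall x, ~ N x} by exists N; split=> // x /contrapT.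
apply: filterS2 NC => x Nx /(_ Nx) /= [].
by [].
Qed.

End DominatedZeroIntegral.

Section BorelMeasurability.
Context {R : realType} {X : ptopologicalType}.

Lemma open_measurable_borel (A : set X) : open A -> measurable (A : set (borel X)).
Proof. by move=> oA; exact: sub_sigma_algebra. Qed.

Lemma continuous_measurable_on (D : set X) (f : X -> R) : open D ->
  (forall x, D x -> {for x, continuous f}) -> measurable_fun (D : set (borel X)) f.
Proof.
move=> oD fc; apply: (measurability _ (RGenOInfty.measurableE R)) => _ [_ [r ->] <-].
apply: open_measurable_borel; rewrite openE => x [Dx fx].
apply: filterI; first exact: open_nbhs_nbhs.
by apply: (fc x Dx); apply: open_nbhs_nbhs; split=> //; exact: interval_open.
Qed.

End BorelMeasurability.

(** * The paraboloid and the bump function built on it *)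

Section Paraboloid.
Context {R : realType} {n : nat}.
Implicit Types (x y z v w : 'rV[R]_n) (r : R) (U : set 'rV[R]_n).

Definition paraboloid z r x : R := r - sqnorm (x - z).

Definition closed_ball2 z r : set 'rV[R]_n := [set x | sqnorm (x - z) <= r].

Lemma sqnormN v : sqnorm (- v) = sqnorm v.
Proof. by apply: eq_bigr => a _; rewrite mxE sqrrN. Qed.

Lemma sqnormD_le v w : sqnorm (v + w) <= 2 * sqnorm v + 2 * sqnorm w.
Proof.
rewrite /sqnorm !mulr_sumr -big_split /=; apply: ler_sum => a _.
by rewrite mxE; have := sqr_ge0 (v 0 a - w 0 a); nra.
Qed.

(** The inner map [u] is the identity in the chart of the ball and a transition map in any other
    chart. *)
Lemma Ck_on_paraboloid m k (U : set 'rV[R]_m) (u : 'rV[R]_m -> 'rV[R]_n) z r : open U ->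
  (forall a, Ck_on k U (fun t : 'rV[R]_m => u t 0 a)) ->
  Ck_on k U (fun t : 'rV[R]_m => paraboloid z r (u t)).
Proof.
move=> oU uk; apply: (@Ck_on_eq _ _ _ _ (fun t : 'rV[R]_m => r + (-1) *
    \sum_a (u t 0 a + - z 0 a) * (u t 0 a + - z 0 a))) => // [t _|].
  rewrite mulN1r /paraboloid; congr (_ - _); apply: eq_bigr => a _.
  by rewrite !mxE expr2.
have ck a : Ck_on k U (fun t : 'rV[R]_m => u t 0 a + - z 0 a) by apply: Ck_onD => //; exact: Ck_on_cst.
apply: Ck_onD => //; first exact: Ck_on_cst.
apply: Ck_onM => //; first exact: Ck_on_cst.
by apply: Ck_on_sum => // a; exact: Ck_onM.
Qed.

Lemma smooth_paraboloid k U z r : open U -> Ck_on k U (paraboloid z r).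
Proof.
by move=> oU; apply: (@Ck_on_paraboloid _ _ _ id) => // a; exact: Ck_on_coord.
Qed.

Lemma paraboloid_continuous z r : continuous (paraboloid z r).
Proof.
by move=> x; apply: Ck_on_continuous (smooth_paraboloid 0 z r openT) _.
Qed.

Lemma gradient_paraboloid z r x : gradient (paraboloid z r) x = (-2) *: (x - z).
Proof.
apply/rowP => c; rewrite !mxE.
have E : paraboloid z r = fun y => r + (-1) * \sum_a (y 0 a + - z 0 a) * (y 0 a + - z 0 a).
  apply/funext => y; rewrite mulN1r /paraboloid; congr (_ - _); apply: eq_bigr => a _.
  by rewrite !mxE expr2.
have dc (k : R) : derivable (fun _ : 'rV[R]_n => k) x (delta_mx 0 c) by exact: derivable_cst.
have d1 a : derivable (fun y : 'rV[R]_n => y 0 a + - z 0 a) x (delta_mx 0 c).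
  by have [d _] := is_derive_coord a c x; exact: (derivableD d (dc _)).
have d2 a := derivableM (d1 a) (d1 a).
have [ds es] := pderiv_sum (index_enum _) d2.
rewrite E (pderivD (dc r) (derivableM (dc (-1)) ds)) pderiv_cst add0r.
rewrite (pderivM (dc (-1)) ds) pderiv_cst mul0r add0r es mulN1r.
rewrite (bigD1 c) //= big1 ?addr0 => [|a ac].
  have [d _] := is_derive_coord c c x.
  rewrite (pderivM (d1 c) (d1 c)) (pderivD d (dc _)) pderiv_coord pderiv_cst eqxx.
  by rewrite -[true%:R]/(1 : R) addr0; ring.
have [d _] := is_derive_coord a c x.
rewrite (pderivM (d1 a) (d1 a)) (pderivD d (dc _)) pderiv_coord pderiv_cst.
by rewrite eq_sym (negbTE ac) addr0 mul0r mulr0 addr0.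
Qed.

Lemma sqnormZ (c : R) v : sqnorm (c *: v) = c ^+ 2 * sqnorm v.
Proof. by rewrite /sqnorm mulr_sumr; apply: eq_bigr => a _; rewrite mxE exprMn. Qed.

Lemma closed_ball2_closed z r : closed (closed_ball2 z r).
Proof.
have -> : closed_ball2 z r = paraboloid z r @^-1` [set t | 0 <= t].
  by apply/seteqP; split=> x; rewrite /closed_ball2 /paraboloid /= subr_ge0.
by apply: closed_comp => [x _|]; [exact: paraboloid_continuous|exact: closed_ge].
Qed.

Lemma norm_le_of_sqnorm v (e : R) : 0 <= e -> sqnorm v <= e ^+ 2 -> `|v| <= e.
Proof.
move=> e0 ve; apply: mx_norm_leP => // i a; rewrite ord1.
rewrite -(@ler_pXn2r _ 2) ?nnegrE // real_normK ?num_real //.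
exact: le_trans (sqr_le_sqnorm v a) ve.
Qed.

Lemma closed_ball2_compact z r : compact (closed_ball2 z r).
Proof.
apply: bounded_closed_compact; last exact: closed_ball2_closed.
exists (`|z| + (`|r| + 1)); split; first exact: num_real.
move=> N hN x xr; apply: le_trans (ltW hN).
(* [r <= (|r| + 1)^2] bounds the radius without a square root, for any sign of [r]. *)
have h : `|x - z| <= `|r| + 1.
  apply: norm_le_of_sqnorm; first by rewrite addr_ge0.
  by apply: le_trans xr _; have := ler_norm r; have := normr_ge0 r; nra.
by rewrite -[x](subrK z) addrC (le_trans (ler_normD _ _)) // lerD.
Qed.

Lemma open_closed_ball2 U x : open U -> U x ->
  exists2 r : R, 0 < r & closed_ball2 x r `<=` U.
Proof.
move=> oU Ux; have [e e0 eU] := open_rV_ball oU Ux.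
exists ((e / 2) ^+ 2); first by rewrite exprn_gt0 // divr_gt0.
move=> y yx; apply: eU; apply: le_lt_trans (norm_le_of_sqnorm _ yx) _.
  by rewrite divr_ge0 // ltW.
by rewrite ltr_pdivrMr // ltr_pMr // ltr1n.
Qed.

End Paraboloid.

Section Bump.
Context {R : realType} {n : nat} {M : manifold R n}.
Variables (i : chart_index M) (z : 'rV[R]_n) (r b : R).
Hypotheses (b0 : 0 < b) (ball_img : closed_ball2 z r `<=` img i).

Definition bump (p : M) : R :=
  if `[< dom i p >] then flat b 0 (paraboloid z r (coord i p)) else 0.

Let KM : set M := param i @` closed_ball2 z r.

Lemma bump_in p : dom i p -> bump p = flat b 0 (paraboloid z r (coord i p)).
Proof. by move=> ip; rewrite /bump asboolT. Qed.

Lemma ball_image_compact : compact KM.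
Proof.
apply: continuous_compact; last exact: closed_ball2_compact.
apply: continuous_in_subspaceT => x; rewrite inE => /ball_img ix.
exact: param_continuous_at.
Qed.

(** The Hausdorff axiom enters here: the complement of [KM] is open, so [bump] vanishes in a
    neighbourhood of every point off the chart. *)
Lemma ball_image_closed : closed KM.
Proof. exact: (compact_closed (@hausdorff_carrier _ _ M) ball_image_compact). Qed.

Lemma ball_imageP p : KM p -> dom i p /\ closed_ball2 z r (coord i p).
Proof.
move=> [x xr <-]; split; first exact/dom_param/ball_img.
by rewrite coordK //; exact: ball_img.
Qed.

Lemma bump_out p : ~ KM p -> bump p = 0.
Proof.
move=> pK; rewrite /bump; case: asboolP => // ip; apply: flat_le0.
rewrite /paraboloid subr_le0 leNgt; apply/negP => h; apply: pK.
by exists (coord i p); [exact: ltW|exact: paramK].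
Qed.

(** In another chart, points of [dom i] see the flat function composed with a smooth map; the
    remaining points lie in the open complement of [KM], where [bump] is zero. *)
Lemma bump_test_function : test_function bump.
Proof.
split; last first.
  apply: (subclosed_compact _ ball_image_compact); first exact: closed_closure.
  rewrite [X in _ `<=` X](closure_id _).1; last exact: ball_image_closed.
  by apply: closureS => p /eqP bp; apply: contrapT => /bump_out.
move=> j k; apply: Ck_on_local => x jx.
have [ip|ip] := pselect (dom i (param j x)).
  exists (overlap j i); first by split.
  have oV : open (overlap j i) := @open_overlap _ _ _ j i.
  apply: (@Ck_on_eq _ _ _ _ (flat b 0 \o (fun y => paraboloid z r (coord i (param j y))))) => //.
    by move=> y [_ iy]; rewrite /= bump_in.
  apply: (@Ck_on_comp_family _ _ (flat b) (fun m => - m%:R) (fun=> b) S (fun m => m.+2)) => //.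
    by move=> m s; exact: is_derive_flat.
  by apply: Ck_on_paraboloid => // a; exact: transition_Ck.
exists (img j `&` param j @^-1` (~` KM)).
  by split=> // /ball_imageP[].
apply: (@Ck_on_eq _ _ _ _ (fun=> 0)); last exact: Ck_on_cst.
  by apply: open_img_preimage; exact/closed_openC/ball_image_closed.
by move=> y [_ yK]; rewrite /= bump_out.
Qed.

Variable g : metric M.

Lemma hess_bump p : dom i p -> let t := paraboloid z r (coord i p) in
  hess g bump i p = (b * (- 2 * flat b 3 t + b * flat b 4 t)) *:
      ((gradient (paraboloid z r) (coord i p))^T *m gradient (paraboloid z r) (coord i p))
    + (b * flat b 2 t) *: hessian (metric_in g i) (paraboloid z r) (coord i p).
Proof.
move=> ip t; rewrite hessE //.
have oi : open (img i) := @open_img _ _ _ i.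
have -> : hessian (metric_in g i) (bump \o param i) (coord i p) =
    hessian (metric_in g i) (flat b 0 \o paraboloid z r) (coord i p).
  apply: (hessian_eq_on _ oi (img_coord ip)) => y iy.
  by rewrite /= bump_in ?coordK //; exact: dom_param.
(* [flat b 0] is [G]; this line and the next compute [G'] and [G'']. *)
have F1 (u : R) : is_derive u 1 (flat b 0) (b * flat b 2 u).
  by have := is_derive_flat 0 u b0; rewrite oppr0 mul0r add0r.
have F2 (u : R) : is_derive u 1 (fun t => b * flat b 2 t) (b * (- 2 * flat b 3 u + b * flat b 4 u)).
  by have H := @is_deriveZ R R R _ b u 1 _ (is_derive_flat 2 u b0).
exact: hessian_comp oi (img_coord ip) (smooth_paraboloid 2 z r oi) F1 F2.
Qed.

Lemma hess_bump_out j p : dom j p -> ~ KM p -> hess g bump j p = 0.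
Proof.
move=> jp pK; apply: (@hess_local0 _ _ _ _ _ _ _ (~` KM)) => //.
  exact/closed_openC/ball_image_closed.
by move=> q; exact: bump_out.
Qed.

End Bump.

(** * The pointwise lower bound for the integrand *)

Section Propagation.
Context {R : realType} {n : nat} {M : manifold R n}.
Variables (g : metric M) (T : sym2tensor M).

Lemma metric_entry_continuous i p a b : dom i p ->
  {for p, continuous (fun q => g i q a b)}.
Proof.
move=> ip; have FF : Filter (nbhs p) by exact: nbhs_filter.
have xi : {for coord i p, continuous (fun x => g i (param i x) a b)}.
  exact: Ck_on_continuous (metric_smooth g i a b 0) (img_coord ip).
have H : {for p, continuous (fun q => g i (param i (coord i q)) a b)}.
  exact: (continuous_comp (coord_continuous_at ip) xi).
change (g i q a b @[q --> p] --> g i p a b).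
have E : g i (param i (coord i p)) a b = g i p a b by rewrite paramK.
rewrite -E; apply: cvg_trans H; apply: near_eq_cvg.
have : nbhs p (dom i) by apply: open_nbhs_nbhs; split=> //; exact: open_dom.
by apply: filterS => q iq; rewrite paramK.
Qed.

Lemma invmx_metric_continuous i p a b : dom i p ->
  {for p, continuous (fun q => invmx (g i q) a b)}.
Proof.
move=> ip; have FF : Filter (nbhs p) by exact: nbhs_filter.
change (invmx (g i q) a b @[q --> p] --> invmx (g i p) a b).
apply: cvg_invmx; first exact: metric_unit.
  have : nbhs p (dom i) by apply: open_nbhs_nbhs; split=> //; exact: open_dom.
  by apply: filterS => q iq; exact: metric_unit.
by move=> k l; exact: metric_entry_continuous.
Qed.

Lemma flat_continuous b m : 0 < b -> continuous (flat b m : R -> R).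
Proof.
move=> b0 t; apply: differentiable_continuous; apply/derivable1_diffP.
by have [] := is_derive_flat m t b0.
Qed.

Variables (i : chart_index M) (z : 'rV[R]_n) (r b : R).
Hypothesis b0 : 0 < b.

(** This is [G'(s)]. *)
Definition weight (p : M) : R := b * flat b 2 (paraboloid z r (coord i p)).

Lemma weight_ge0 p : 0 <= weight p.
Proof. by rewrite mulr_ge0 ?flat_ge0 // ltW. Qed.

(** The minorant of the integrand. It must be nonnegative everywhere while [T >= 0] holds only
    almost everywhere, whence the absolute value. *)
Definition weighted_trace : M -> R :=
  (fun p => weight p * `|\tr (invmx (g i p) *m T i p)|) \_ (dom i).

Lemma weighted_trace_in p : dom i p ->
  weighted_trace p = weight p * `|\tr (invmx (g i p) *m T i p)|.
Proof. by move=> ip; rewrite /weighted_trace patchE mem_set. Qed.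

Lemma weighted_trace_out p : ~ dom i p -> weighted_trace p = 0.
Proof. by move=> ip; rewrite /weighted_trace patchE memNset. Qed.

Lemma weighted_trace_ge0 p : 0 <= weighted_trace p.
Proof.
have [ip|ip] := pselect (dom i p); last by rewrite weighted_trace_out.
by rewrite weighted_trace_in // mulr_ge0 // weight_ge0.
Qed.

Lemma measurable_weighted_trace :
  (forall a c, measurable_fun (dom i : set (borel M)) (fun p => T i p a c)) ->
  measurable_fun [set: borel M] (weighted_trace : borel M -> R).
Proof.
move=> Tm; have mD : measurable (dom i : set (borel M)).
  by apply: open_measurable_borel; exact: open_dom.
apply/(measurable_restrictT _ mD); apply: measurable_funM.
  apply: continuous_measurable_on; first exact: open_dom.
  move=> p ip; apply: (@continuous_comp _ _ _ (fun p => paraboloid z r (coord i p))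
    (fun t => b * flat b 2 t)).
    apply: continuous_comp; first exact: coord_continuous_at.
    exact: paraboloid_continuous.
  by apply: continuousM; [exact: cst_continuous|exact: flat_continuous].
apply: (measurableT_comp (@normr_measurable R setT)).
apply: measurable_sum => a.
have -> : (fun p => (invmx (g i p) *m T i p) a a) =
    (fun p => \sum_c invmx (g i p) a c * T i p c a) by apply/funext => p; rewrite mxE.
apply: measurable_sum => c; apply: measurable_funM; last exact: Tm.
apply: continuous_measurable_on; first exact: open_dom.
by move=> p ip; exact: invmx_metric_continuous.
Qed.

(** On the annulus [|ds|^2 / k >= 4 eps / (B2 Bk)], and the Hessian of [s] costs at most [B3 B1].
    [A] is the ratio [G''/G'] for which the first term exceeds the second by a full [G']. *)
Lemma hess_bump_estimate (eps A B1 B2 B3 Bk k : R) p : closed_ball2 z r `<=` img i ->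
  dom i p -> psd (T i p) ->
  (forall v, k^-1 * \tr (invmx (g i p) *m T i p) * quadform (g i p) v <= quadform (T i p) v) ->
  0 < eps -> eps <= sqnorm (coord i p - z) -> 0 < paraboloid z r (coord i p) ->
  0 < k -> k <= Bk -> entry_sum (invmx (g i p)) <= B1 ->
  entry_sum (g i p) <= B2 -> 0 < B2 ->
  entry_sum (hessian (metric_in g i) (paraboloid z r) (coord i p)) <= B3 ->
  A = (1 + B3 * B1) * Bk * B2 / (4 * eps) -> b = A * r ^+ 2 + 2 * r ->
  weight p * \tr (invmx (g i p) *m T i p) <=
    pairing (g i p) (T i p) (hess g (bump i z r b) i p).
Proof.
move=> ball ip Tp Tk e0 ep t0 k0 kB h1 h2 B20 h3 AE bE.
have gs := metric_sym g ip; have gp := metric_posdef_at g ip.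
have Ts := components_sym T ip.
set tau := \tr _; have tau0 : 0 <= tau := trace_ge0 gs gp Ts Tp.
rewrite hess_bump //; set t := paraboloid z r (coord i p) in t0 *.
set H := hessian _ _ _ in h3 *; set w := gradient _ _.
have E1 : 0 <= entry_sum (invmx (g i p)) := entry_sum_ge0 _.
have E3 : 0 <= entry_sum H := entry_sum_ge0 _.
have B10 : 0 <= B1 := le_trans E1 h1.
have B30 : 0 <= B3 := le_trans E3 h3.
have Bk0 : 0 < Bk := lt_le_trans k0 kB.
have BB0 : 0 < 1 + B3 * B1 by rewrite ltr_pwDl // mulr_ge0.
have A0 : 0 < A by rewrite AE !(mulr_gt0, invr_gt0).
have tr : t <= r by rewrite /t /paraboloid lerBlDr lerDl sqnorm_ge0.
have F10 : 0 <= b * flat b 2 t by rewrite mulr_ge0 ?flat_ge0 // ltW.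
have F2E : b * (- 2 * flat b 3 t + b * flat b 4 t) = (b * flat b 2 t) * ((b - 2 * t) / t ^+ 2).
  rewrite -[flat b 3 t]/(flat b (2 + 1) t) -[flat b 4 t]/(flat b (2 + 2) t) !flatD //.
  by field; rewrite gt_eqF.
(* The choice of [b] is exactly what [A t^2 + 2 t <= b] requires at the largest value [t = r]. *)
have AF : A <= (b - 2 * t) / t ^+ 2.
  rewrite ler_pdivlMr ?exprn_gt0 // bE.
  have : A * t ^+ 2 <= A * r ^+ 2.
    by rewrite ler_wpM2l ?(ltW A0) // lerXn2r ?nnegrE ?(ltW t0) // (le_trans (ltW t0)).
  lra.
set F1 := b * flat b 2 t in F10 F2E *; set F2 := b * _ in F2E *.
have F2A : F1 * A <= F2 by rewrite F2E ler_wpM2l.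
have F20 : 0 <= F2 by apply: le_trans F2A; rewrite mulr_ge0 // ltW.
(* [sqnorm_le_quadform] is used for the inverse metric, whose own inverse is [g]; the gradient has
   squared norm [4 |x - z|^2]. *)
have q1 : 4 * eps / B2 <= quadform (invmx (g i p)) w.
  have wE : sqnorm w = 4 * sqnorm (coord i p - z).
    by rewrite /w gradient_paraboloid sqnormZ; congr (_ * _); ring.
  have := sqnorm_le_quadform (invmx_sym gs) (posdef_invmx gs gp) w.
  rewrite invmxK wE => hq.
  rewrite ler_pdivrMr // [X in _ <= X]mulrC.
  apply: (@le_trans _ _ (entry_sum (g i p) * quadform (invmx (g i p)) w)).
    by apply: le_trans hq; rewrite ler_pM2l.
  by apply: ler_wpM2r h2; exact: posdef_psd (posdef_invmx gs gp) w.
have key : F1 <= F2 * (k^-1 * quadform (invmx (g i p)) w)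
    - F1 * (entry_sum H * entry_sum (invmx (g i p))).
  have EE : entry_sum H * entry_sum (invmx (g i p)) <= B3 * B1 by exact: ler_pM.
  have kq : Bk^-1 * (4 * eps / B2) <= k^-1 * quadform (invmx (g i p)) w.
    apply: ler_pM => //; first by rewrite invr_ge0 ltW.
      by rewrite !(mulr_ge0, invr_ge0) // ltW.
    by rewrite lef_pV2.
  have AA : A * (Bk^-1 * (4 * eps / B2)) = 1 + B3 * B1.
    by rewrite AE; field; rewrite !gt_eqF.
  have s1 : F1 * A * (Bk^-1 * (4 * eps / B2)) <= F2 * (k^-1 * quadform (invmx (g i p)) w).
    apply: ler_pM => //; first by rewrite mulr_ge0 // ltW.
    by rewrite !(mulr_ge0, invr_ge0) // ltW.
  rewrite -mulrA AA in s1.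
  have s2 := ler_wpM2l F10 EE; lra.
have lb := @pairing_lower_bound _ _ _ gs gp (T i p) H w k^-1 F2 F1 Ts Tp Tk F20 F10.
apply: le_trans lb; rewrite -/tau mulrC.
by rewrite ler_wpM2l.
Qed.

End Propagation.

(** * Propagation of the vanishing set and the connectedness argument *)

Section AlmostEverywhere.
Context d (X : measurableType d) (R : realType) (mu : {measure set X -> \bar R}).
Implicit Types P Q S : X -> Prop.

Lemma ae_imp P Q : (forall x, P x -> Q x) ->
  {ae mu, forall x, P x} -> {ae mu, forall x, Q x}.
Proof. by move=> PQ; apply: filterS. Qed.

Lemma ae_imp2 P1 P2 Q : (forall x, P1 x -> P2 x -> Q x) ->
  {ae mu, forall x, P1 x} -> {ae mu, forall x, P2 x} -> {ae mu, forall x, Q x}.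
Proof. by move=> PQ; apply: filterS2. Qed.

Lemma ae_imp3 P1 P2 P3 Q : (forall x, P1 x -> P2 x -> P3 x -> Q x) ->
  {ae mu, forall x, P1 x} -> {ae mu, forall x, P2 x} -> {ae mu, forall x, P3 x} ->
  {ae mu, forall x, Q x}.
Proof. by move=> PQ; apply: filterS3. Qed.

End AlmostEverywhere.

Section UniqueContinuation.
Context {R : realType} {n : nat} {M : manifold R n}.
Variables (g : metric M) (dV : {measure set (borel M) -> \bar R}) (T : sym2tensor M).
Hypothesis T_measurable : forall i a c,
  measurable_fun (dom i : set (borel M)) (fun p => T i p a c).
Hypothesis T_ge0 : {ae dV, forall p, tensor_ge0 T p}.
Hypothesis T_hess : forall phi : M -> R, test_function phi ->
  (\int[dV]_p (tensor_inner g T (hess g phi) p)%:E = 0)%E.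
Variable kappa : M -> R.
Hypothesis kappa_ge : forall p, n%:R <= kappa p.
Hypothesis kappa_bounded : forall K : set M, compact K ->
  exists B : R, forall p, K p -> kappa p <= B.
Hypothesis T_ge :
  {ae dV, forall p, tensor_le ((kappa p)^-1 * tensor_trace g T p) g T p}.

Lemma local_propagation i z r eps : (0 < n)%N -> 0 < eps ->
  closed_ball2 z r `<=` img i ->
  {ae dV, forall p, dom i p -> sqnorm (coord i p - z) < eps -> tensor_eq0 T p} ->
  {ae dV, forall p, dom i p -> sqnorm (coord i p - z) < r -> tensor_eq0 T p}.
Proof.
move=> n0 e0 ball T_eps.
have kappa0 p : 0 < kappa p by apply: lt_le_trans (kappa_ge p); rewrite ltr0n.
have cK := @closed_ball2_compact R n z r.
have oi : open (img i) := @open_img _ _ _ i.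
have ci x a c : closed_ball2 z r x -> {for x, continuous (fun y => invmx (g i (param i y)) a c)}.
  move=> /ball ix; apply: (@continuous_comp _ _ _ (param i) (fun q => invmx (g i q) a c)).
    exact: param_continuous_at.
  by apply: invmx_metric_continuous; exact: dom_param.
have cg x a c : closed_ball2 z r x -> {for x, continuous (fun y => g i (param i y) a c)}.
  move=> /ball ix; apply: (@continuous_comp _ _ _ (param i) (fun q => g i q a c)).
    exact: param_continuous_at.
  by apply: metric_entry_continuous; exact: dom_param.
have [B1 B10 hB1] := compact_bounded_entries cK ci.
have [B2 B20 hB2] := compact_bounded_entries cK cg.
have Gu y : img i y -> metric_in g i y \in unitmx by move=> iy; exact/metric_unit/dom_param.
have ch x a c : closed_ball2 z r x ->
    {for x, continuous (fun y => hessian (metric_in g i) (paraboloid z r) y a c)}.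
  move=> /ball ix.
  exact: (@continuous_hessian R n (img i) (metric_in g i) (paraboloid z r) x a c oi ix
    (fun k l => metric_smooth g i k l 1) Gu (smooth_paraboloid 2 z r oi)).
have [B3 B30 hB3] := compact_bounded_entries cK ch.
have [Bk0 hBk0] := kappa_bounded (ball_image_compact ball).
(* The maximum with 1 keeps [Bk] positive even if the ball is empty and [Bk0] arbitrary. *)
pose Bk := Num.max Bk0 1; pose A := (1 + B3 * B1) * Bk * B2 / (4 * eps).
have Bk_gt0 : 0 < Bk by rewrite lt_max ltr01 orbT.
have A0 : 0 < A by rewrite /A !(mulr_gt0, invr_gt0) // addr_gt0 // mulr_gt0.
have [r0|r0] := leP r 0.
  apply: aeW => p _ h; have := lt_le_trans h r0.
  by rewrite ltNge sqnorm_ge0.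
(* For [G s = exp (- b / s)] this gives [G'' / G' = (b - 2 s) / s ^ 2 >= A] on [(0, r]]. *)
pose b := A * r ^+ 2 + 2 * r.
have b0 : 0 < b by rewrite /b addr_gt0 // mulr_gt0 // exprn_gt0.
have sphi := bump_test_function b0 ball.
pose h := weighted_trace g T i z r b.
have hf : {ae dV, forall p, h p <= tensor_inner g T (hess g (bump i z r b)) p}.
  apply: ae_imp3 T_ge0 T_ge T_eps => p Tp Tk Te; rewrite /h.
  have [ip|ip] := pselect (dom i p); last first.
    rewrite weighted_trace_out // tensor_inner_pairing.
    have -> : hess g (bump i z r b) (chart_at p) p = 0.
      apply: (hess_bump_out _ ball); first exact: dom_chart_at.
      by case/(ball_imageP ball).
    by rewrite /pairing mulmx0 mxtrace0.
  rewrite weighted_trace_in // (tensor_inner_hess _ _ sphi.1 ip).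
  have Tpi := tensor_ge0_in ip Tp.
  (* Off the open ball the flat functions vanish, and both sides are zero. *)
  have [t0|t0] := leP (paraboloid z r (coord i p)) 0.
    rewrite /weight hess_bump // !flat_le0 // !mulr0 addr0 mulr0 !scale0r mul0r.
    by rewrite addr0 /pairing mulmx0 mxtrace0.
  (* Near the centre, where the gradient of [s] degenerates, both sides vanish because [T] does. *)
  have [se|se] := ltP (sqnorm (coord i p - z)) eps.
    rewrite ((tensor_eq0_in T ip).1 (Te ip se)) /pairing !mulmx0 !mul0mx mxtrace0.
    by rewrite normr0 mulr0.
  have Ts := components_sym T ip.
  rewrite ger0_norm ?(trace_ge0 (metric_sym g ip) (metric_posdef_at g ip)) //.
  have Kp : closed_ball2 z r (coord i p) by apply: ltW; rewrite -subr_gt0.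
  apply: (@hess_bump_estimate _ _ _ g T i z r b b0 eps A B1 B2 B3 Bk (kappa p)) => //.
  - by move=> v; have := tensor_le_in ip Tk v; rewrite (tensor_trace_in g T ip).
  - rewrite le_max (hBk0 p) //; exists (coord i p) => //; exact: paramK.
  - by have := hB1 _ Kp; rewrite paramK.
  - by have := hB2 _ Kp; rewrite paramK.
  - exact: hB3.
have mh := measurable_weighted_trace g z r b0 (@T_measurable i).
have h0 := integral_eq0_dominated mh (weighted_trace_ge0 g T i z r b0) hf (T_hess sphi).
apply: ae_imp2 T_ge0 h0 => p Tp hp ip sr.
apply/(tensor_eq0_in T ip); have Ts := components_sym T ip.
apply: (trace_eq0 (metric_sym g ip) (metric_posdef_at g ip) Ts (tensor_ge0_in ip Tp)).
move: hp; rewrite weighted_trace_in // => /eqP; rewrite mulf_eq0 normr_eq0.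
case/orP => /eqP // w0; have t0 : 0 < paraboloid z r (coord i p) by rewrite subr_gt0.
by have := mulr_gt0 b0 (flat_gt0 b 2 t0); rewrite -/(weight _ _ _ _ _) w0 ltxx.
Qed.

Definition vanishing_set : set M :=
  [set p | exists A : set M, [/\ open A, A p & {ae dV, forall q, A q -> tensor_eq0 T q}]].

Lemma vanishing_set_open : open vanishing_set.
Proof.
rewrite openE => p [A [oA Ap A0]]; apply: (filterS _ (open_nbhs_nbhs (conj oA Ap))).
by move=> q Aq; exists A.
Qed.

(** [local_propagation] is applied around a vanishing point [q] close to [p], on a ball containing
    [p] and still inside the chart image. *)
Lemma vanishing_set_closed : (0 < n)%N -> closed vanishing_set.
Proof.
move=> n0 p clp; pose i := chart_at p; have ip : dom i p := dom_chart_at p.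
have oi : open (img i) := @open_img _ _ _ i.
have [r r0 ball] := open_closed_ball2 oi (img_coord ip).
(* By [sqnormD_le], two steps of squared length at most [e] have a sum of squared length at most
   [4 e = r]. *)
pose e := r / 4; have e0 : 0 < e by rewrite divr_gt0.
pose N (x : 'rV[R]_n) (s : R) := dom i `&` coord i @^-1` [set y | sqnorm (y - x) < s].
have oN x s : open (N x s).
  apply: open_dom_preimage.
  have -> : [set y | sqnorm (y - x) < s] = paraboloid x s @^-1` [set t | 0 < t].
    by apply/seteqP; split=> y; rewrite /paraboloid /= subr_gt0.
  by apply: open_comp; [move=> y _; exact: paraboloid_continuous|exact: open_gt].
have sq0 x : sqnorm (x - x) = 0 :> R.
  by rewrite subrr /sqnorm big1 // => a _; rewrite mxE expr0n.
have Np : N (coord i p) e p by split=> //; rewrite /= sq0.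
have [q [[A [oA Aq A0]] [iq qe]]] := clp _ (open_nbhs_nbhs (conj (oN _ _) Np)).
have oAx : open (img i `&` param i @^-1` A) by exact: open_img_preimage.
have [eps eps0 epsA] : exists2 eps : R, 0 < eps &
    closed_ball2 (coord i q) eps `<=` img i `&` param i @^-1` A.
  by apply: open_closed_ball2 => //; split; [exact: img_coord|rewrite /= paramK].
have ballq : closed_ball2 (coord i q) e `<=` img i.
  move=> y hy; apply: ball; rewrite /closed_ball2 /=.
  have -> : y - coord i p = (y - coord i q) + (coord i q - coord i p) by rewrite subrKA.
  apply: le_trans (sqnormD_le _ _) _; rewrite /closed_ball2 /= in hy.
  have := ltW qe; rewrite /= /e in hy *; lra.
have Teps : {ae dV, forall p', dom i p' -> sqnorm (coord i p' - coord i q) < eps -> tensor_eq0 T p'}.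
  apply: ae_imp A0 => p' Ap' ip' h; apply: Ap'.
  by have [_] := epsA (coord i p') (ltW h); rewrite /= paramK.
exists (N (coord i q) e); split.
- exact: oN.
- by split=> //; rewrite /= -sqnormN opprB.
- apply: ae_imp (local_propagation n0 eps0 ballq Teps) => p' H [ip' h].
  exact: H.
Qed.

(** The null sets attached to the points are too many to unite. Second countability replaces the
    neighbourhoods by countably many basic open sets on which [T] vanishes almost everywhere. *)
Lemma ae_of_vanishing_cover : vanishing_set = setT -> {ae dV, forall p, tensor_eq0 T p}.
Proof.
move=> VT; have [B cB [Bo Bb]] := @second_countable_carrier _ _ M.
have /countable_injP[f finj] := cB.
pose good (A : set M) := B A /\ {ae dV, forall q, A q -> tensor_eq0 T q}.
pose bad := [set p : M | ~ tensor_eq0 T p].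
(* Basic sets are numbered by the injection [f]; [F k] is empty when no good basic set has number
   [k]. *)
pose F (k : nat) := [set p | bad p /\ exists A, [/\ good A, f A = k & A p]].
have FN k : dV.-negligible (F k : set (borel M)).
  have [[A [gA fA]]|nA] := pselect (exists A, good A /\ f A = k); last first.
    apply: (@negligibleS _ _ _ _ set0); last exact: negligible_set0.
    by move=> p [_ [A [gA fA _]]]; apply: nA; exists A.
  apply: negligibleS gA.2 => p [bp [A' [gA' fA' A'p]]] /= H; apply: bp; apply: H.
  have -> // : A = A' by apply: finj; rewrite ?inE ?fA ?fA' //; [exact: gA.1|exact: gA'.1].
apply: negligibleS (negligible_bigcup FN) => p bp.
have [A [oA Ap A0]] : vanishing_set p by rewrite VT.
have [C [BC Cp] CA] := Bb p A (open_nbhs_nbhs (conj oA Ap)).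
exists (f C) => //; split=> //; exists C; split=> //; split=> //.
by apply: ae_imp A0 => q Aq /CA; exact: Aq.
Qed.

End UniqueContinuation.

Unset Implicit Arguments.

Theorem theorem1p3 (R : realType) (n : nat) (M : manifold R n)
  (connM : connected [set: M]) (g : metric M)
  (dV : {measure set (borel M) -> \bar R}) (dVE : is_volume g dV)
  (T : sym2tensor M) (TL1 : L1loc g dV T)
  (T_ge0 : {ae dV, forall p, tensor_ge0 T p})
  (T_hess : forall phi : M -> R, test_function phi ->
     (\int[dV]_p (tensor_inner g T (hess g phi) p)%:E = 0)%E)
  (kappa : M -> R) (kappa_ge : forall p, n%:R <= kappa p)
  (kappa_bounded : forall K : set M, compact K ->
     exists B : R, forall p, K p -> kappa p <= B)
  (T_ge : {ae dV, forall p, tensor_le ((kappa p)^-1 * tensor_trace g T p) g T p})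
  (U : set M) (openU : open U) (U_neq0 : U !=set0)
  (T_U : {ae dV, forall p, U p -> tensor_eq0 T p}) :
  {ae dV, forall p, tensor_eq0 T p}.
Proof.
have [n0|n0] := posnP n.
  (* In dimension 0 a tensor has no components. Otherwise [n <= kappa] makes [kappa] positive, as
     the propagation demands. *)
  by apply: aeW => p; rewrite /tensor_eq0; apply/matrixP => a; have := ltn_ord a; rewrite {2}n0.
have Tm := TL1.1.
apply: ae_of_vanishing_cover.
apply: connM.
- have [p Up] := U_neq0; exists p, U; split=> //.
- exists (vanishing_set dV T); last by rewrite setTI.
  exact: vanishing_set_open.
- exists (vanishing_set dV T); last by rewrite setTI.
  exact: (vanishing_set_closed Tm T_ge0 T_hess kappa_ge kappa_bounded T_ge n0).
Qed.
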